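(* Let $\mathcal M$ be a countable MDP with initial state $s_0$, let $\{A_i\}_{i\in\mathbb N}$ be a sequence of sets of transitions of $\mathcal M$ that is monotone decreasing with respect to set inclusion, and consider the objective $\varphi=\bigcap_{i\in\mathbb N}\mathsf G\mathsf F A_i$. (1) If $\mathcal M$ is universally transient, then there exists a deterministic positional strategy that is optimal for $\varphi$ from every state that admits an optimal strategy for $\varphi$. (2) In general, even if $\mathcal M$ is not universally transient, if there exists an optimal strategy for $\varphi$ from $s_0$, then there also exists an optimal deterministic Markov strategy for $\varphi$ from $s_0$.
   Context: An MDP $\mathcal M$ consists of a countable set $S$ of states partitioned into controlled states $S_C$ and random states $S_R$; a transition relation $\longrightarrow\subseteq S\times S$ such that every state has at least one successor (the set $\mathrm{Succ}(s)$ of successors of $s$ may be infinite); and a function $P$ assigning to each random state $s$ a probability distribution on $\mathrm{Succ}(s)$. A run is an infinite sequence $s_0e_0s_1e_1\cdots$ with $e_i=(s_i,s_{i+1})\in\longrightarrow$; a history is a finite prefix of a run ending in a controlled state. A (general) strategy $\sigma$ maps each history ending in $s$ to a probability distribution on $\mathrm{Succ}(s)$; it is deterministic if all these distributions are Dirac, positional if they depend only on the current state, and Markov if they depend only on the current state and the number of steps taken so far. A strategy $\sigma$ and a start state $s$ induce a probability measure $\mathcal P_{\mathcal M,s,\sigma}$ on the Borel $\sigma$-algebra of runs from $s$. For an event $\varphi$, $\mathrm{val}(s)=\sup_\sigma\mathcal P_{\mathcal M,s,\sigma}(\varphi)$ over all strategies; $\sigma$ is optimal for $\varphi$ from $s$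 if $\mathcal P_{\mathcal M,s,\sigma}(\varphi)=\mathrm{val}(s)$. $\mathsf G\mathsf F A$ is the set of runs that take transitions in $A$ infinitely often. $\mathcal M$ is universally transient if for every start state $s_0$ and every strategy $\sigma$, $\mathcal P_{\mathcal M,s_0,\sigma}$-almost every run visits no state infinitely often. *)

(* Defs.v *)
From HB Require Import structures.
From mathcomp Require Import all_boot all_order all_algebra.
From mathcomp Require Import all_classical all_reals all_analysis.
From mathcomp Require Import lra.

Set Implicit Arguments.
Unset Strict Implicit.
Unset Printing Implicit Defensive.

Import Order.TTheory GRing.Theory Num.Theory.
Import numFieldNormedType.Exports.

Local Open Scope classical_set_scope.
Local Open Scope ring_scope.

(* [f] is the mass function of a probability distribution on the subset [X] of
   the countable type [S]; [X] may be infinite. *)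
Definition is_distr (R : realType) (S : countType) (X : {pred S}) (f : S -> R) :=
  [/\ forall t, 0 <= f t,
      forall t, t \notin X -> f t = 0 &
      \esum_(t in [set` X]) (f t)%:E = 1%E].

(* [before f t] is the mass of the states enumerated before [t]. A distribution
   [f] cuts [0, 1[ into consecutive intervals of lengths [f t]; [is_next f t v]
   says that [v] lies in the interval of [t]. *)
Section distr_intervals.
Context {R : realType} {S : countType}.

Let enumf (f : S -> R) (i : nat) : R := oapp f 0 (pickle_inv i).

Definition before (f : S -> R) (t : S) : R := \sum_(i < pickle t) enumf f i.

Definition is_next (f : S -> R) (t : S) (v : R) :=
  before f t <= v < before f t + f t.

Variables (X : {pred S}) (f : S -> R).
Hypothesis f_distr : is_distr X f.

Let enumf_ge0 i : 0 <= enumf f i.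
Proof. by rewrite /enumf; case: pickle_inv => //= t; case: f_distr. Qed.

Let before_add t : before f t + f t = \sum_(i < (pickle t).+1) enumf f i.
Proof. by rewrite big_ord_recr /= /enumf pickleK_inv. Qed.

Let partial_le m n : (m <= n)%N ->
  \sum_(i < m) enumf f i <= \sum_(i < n) enumf f i.
Proof.
move=> mn; rewrite -(subnKC mn) big_split_ord /= lerDl.
by apply: sumr_ge0 => i _.
Qed.

Let enumf_total : (\sum_(i <oo) (enumf f i)%:E = 1)%E.
Proof.
have [f0 fX f1] := f_distr.
rewrite nneseries_esumT; last by move=> i; rewrite lee_fin.
rewrite -f1 (esumID (range (@pickle S))); last by move=> i _; rewrite lee_fin.
rewrite !setTI [X in (_ + X)%E]esum1 ?adde0; last first.
  move=> i /= iS; rewrite /enumf; case E : (pickle_inv i) => [t|]//=.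
  case: iS; exists t => //; have := @pickle_invK S i.
  by rewrite E.
rewrite esum_image; last by move=> x y _ _; exact: (pcan_inj pickleK).
rewrite [RHS]esum_mkcond; apply: eq_esum => t _.
rewrite /enumf pickleK_inv /=; case: ifPn => //.
by rewrite mem_setE => /fX ->.
Qed.

Let partial_le1 n : \sum_(i < n) enumf f i <= 1.
Proof.
rewrite -lee_fin -enumf_total -sumEFin -(big_mkord xpredT (fun i => (enumf f i)%:E)).
by apply: nneseries_lim_ge => i _ _; rewrite lee_fin.
Qed.

Lemma before_ge0 t : 0 <= before f t.
Proof. by apply: sumr_ge0 => i _. Qed.

Lemma before_le1 t : before f t + f t <= 1.
Proof. by rewrite before_add. Qed.

Lemma ex_next v : 0 <= v < 1 -> exists t, is_next f t v.
Proof.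
move=> /andP[v0 v1].
have ex : exists n, v < \sum_(i < n) enumf f i.
  apply/not_existsP => H.
  suff : (1 <= v%:E)%E by rewrite lee_fin leNgt v1.
  rewrite -enumf_total; apply: lime_le.
    by apply: is_cvg_nneseries => i _ _; rewrite lee_fin.
  apply: nearW => n; rewrite big_mkord sumEFin lee_fin leNgt.
  exact/negP.
case: (ex_minnP ex) => -[|n]; first by rewrite big_ord0 ltNge v0.
move=> vn minn; have nv : \sum_(i < n) enumf f i <= v.
  by rewrite leNgt; apply/negP => /minn; rewrite ltnn.
case E : (pickle_inv n) => [t|]; last first.
  by move: vn; rewrite big_ord_recr /= /enumf E addr0 ltNge nv.
have pt : (@pickle S t = n :> nat).
  by have := @pickle_invK S n; rewrite E.
by exists t; rewrite /is_next before_add /before pt nv.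
Qed.

Lemma is_next_inj t t' v : is_next f t v -> is_next f t' v -> t = t'.
Proof.
move=> /andP[t1 t2] /andP[t1' t2']; apply: (pcan_inj pickleK).
case: (ltngtP (pickle t) (pickle t')) => // /partial_le.
- rewrite -before_add => /(le_trans)/(_ t1').
  by rewrite leNgt t2.
- rewrite -before_add => /(le_trans)/(_ t1).
  by rewrite leNgt t2'.
Qed.

Lemma is_next_supp t v : is_next f t v -> t \in X.
Proof.
case/andP=> l r; apply/negP => /negP tX; have [_ fX _] := f_distr.
by move: r; rewrite fX// addr0 ltNge l.
Qed.

Lemma is_next_residual t v : is_next f t v -> 0 <= (v - before f t) / f t < 1.
Proof.
case/andP=> l r; have f0 : 0 < f t by lra.
by rewrite ler_pdivlMr// mul0r subr_ge0 l ltr_pdivrMr// mul1r ltrBlDl.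
Qed.

End distr_intervals.

(* The random states are those outside [controlled]; the value of [prob] at a
   controlled state is unconstrained and never used. *)
Record mdp (R : realType) (S : countType) := MDP {
  controlled : pred S;
  trans : rel S;
  prob : S -> S -> R;
  trans_total : forall s, exists t, trans s t;
  prob_distr : forall s, ~~ controlled s -> is_distr (trans s) (prob s) }.

Definition transitions (R : realType) (S : countType) (M : mdp R S) :
  set (S * S) := [set e | trans M e.1 e.2].

Section runs.
Context {R : realType} {S : countType} (M : mdp R S).

(* A run s_0 e_0 s_1 e_1 ... is recorded by its states, as e_i = (s_i, s_i+1). *)
Record run (s : S) := Run {
  run_state :> nat -> S;
  run_start : run_state 0%N = s;
  run_trans : forall i, trans M (run_state i) (run_state i.+1) }.

Lemma run_inhabited (s : S) : inhabited (run s).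
Proof.
have [nxt nxtP] := choice (trans_total M).
by exists; exists (fun n => iter n nxt s) => // i; exact: nxtP.
Qed.

HB.instance Definition _ (s : S) := gen_eqMixin (run s).
HB.instance Definition _ (s : S) := gen_choiceMixin (run s).
HB.instance Definition _ (s : S) := isPointed.Build (run s)
  (inhabited_witness (run_inhabited s)).

(* The runs from [s] that start with the finite path [s :: p]. *)
Definition cylinder (s : S) (p : seq S) : set (run s) :=
  [set r | mkseq (fun i => r i.+1) (size p) = p].
Arguments cylinder : clear implicits.

(* The Borel sigma-algebra of the product topology ([S] being discrete and
   countable) is the one generated by the cylinders. *)
Definition run_space (s : S) := g_sigma_algebraType (range (cylinder s)).

HB.instance Definition _ (s : S) := Measurable.on (run_space s).

(* [(s0, p)] stands for the finite path [s0 :: p], with current state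
   [last s0 p] after [size p] steps. Every finite path is a prefix of a run by
   [trans_total]. *)
Record history := History {
  hist_path : S * seq S;
  hist_valid : path (trans M) hist_path.1 hist_path.2 &&
               controlled M (last hist_path.1 hist_path.2) }.

HB.instance Definition _ := [isSub for hist_path].

Definition hist_last (h : history) : S := last (hist_path h).1 (hist_path h).2.
Definition hist_steps (h : history) : nat := size (hist_path h).2.

Record strategy := Strategy {
  choose_next :> history -> S -> R;
  strategy_distr : forall h, is_distr (trans M (hist_last h)) (choose_next h) }.

Definition deterministic (sigma : strategy) :=
  forall h, exists t, sigma h = (fun u => (u == t)%:R).

Definition positional (sigma : strategy) :=
  forall h h', hist_last h = hist_last h' -> sigma h = sigma h'.

Definition Markov (sigma : strategy) :=
  forall h h', hist_last h = hist_last h' -> hist_steps h = hist_steps h' ->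
    sigma h = sigma h'.

(* The distribution of the next state after the finite path [s :: p]. *)
Definition step (sigma : strategy) (s : S) (p : seq S) : S -> R :=
  if insub (s, p) is Some h then sigma h else prob M (last s p).

Definition path_prob (sigma : strategy) (s : S) (p : seq S) : R :=
  \prod_(i < size p) step sigma s (take i p) (nth s p i).

Definition is_run_measure (sigma : strategy) (s : S)
    (mu : probability (run_space s) R) :=
  forall p, path (trans M) s p ->
    mu (cylinder s p) = (path_prob sigma s p)%:E.

(* Existence of the measure on runs: the image of the Lebesgue measure on
   [0, 1[ under [sample_run], which reads off the successive states of a run
   from nested intervals; the path [s :: p] has an interval of length
   [path_prob sigma s p] starting at [lower p]. *)
Section run_measure_construction.
Variables (sigma : strategy) (s : S).

Lemma step_distr p : path (trans M) s p ->
  is_distr (trans M (last s p)) (step sigma s p).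
Proof.
move=> sp; rewrite /step; case: insubP => [h _ hE|/=].
  by have := strategy_distr sigma h; rewrite /hist_last hE.
by rewrite sp /=; exact: prob_distr.
Qed.

Definition next_state (p : seq S) (v : R) : S :=
  xget s [set t | is_next (step sigma s p) t v].

Fixpoint refine (u : R) (n : nat) : seq S * R :=
  if n is m.+1 then
    let: (p, v) := refine u m in
    let f := step sigma s p in
    let t := next_state p v in
    (rcons p t, (v - before f t) / f t)
  else ([::], u).

Lemma next_stateP p v : path (trans M) s p -> 0 <= v < 1 ->
  is_next (step sigma s p) (next_state p v) v.
Proof. move=> sp v01; have ex := ex_next (step_distr sp) v01.
exact: (@xgetPex _ s [set t | is_next (step sigma s p) t v] ex). Qed.

Lemma refineP u n : 0 <= u < 1 ->
  path (trans M) s (refine u n).1 /\ 0 <= (refine u n).2 < 1.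
Proof.
move=> u01; elim: n => //= n; case: (refine u n) => p v /= [sp v01].
have nP := next_stateP sp v01.
split; last exact: is_next_residual nP.
by have := is_next_supp (step_distr sp) nP; rewrite rcons_path sp.
Qed.

Lemma refine_mkseq u n :
  mkseq (fun i => last s (refine u i.+1).1) n = (refine u n).1.
Proof.
elim: n => // n IH; rewrite mkseqS IH /=.
by case: (refine u n) => p v /=; rewrite last_rcons.
Qed.

Definition truncate01 (u : R) : R := if 0 <= u < 1 then u else 0.

Lemma truncate01P u : 0 <= truncate01 u < 1.
Proof. by rewrite /truncate01; case: ifP => //; rewrite lexx ltr01. Qed.

Lemma refine_trans u i : 0 <= u < 1 ->
  trans M (last s (refine u i).1) (last s (refine u i.+1).1).
Proof.
move=> u01; have [+ _] := refineP i.+1 u01.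
rewrite /=; case: (refine u i) => p v /=.
by rewrite last_rcons rcons_path => /andP[].
Qed.

Definition sample_run (u : R) : run_space s :=
  @Run s (fun n => last s (refine (truncate01 u) n).1) erefl
    (fun i => refine_trans i (truncate01P u)).

Lemma sample_run_cylinder u p :
  cylinder s p (sample_run u) <-> (refine (truncate01 u) (size p)).1 = p.
Proof. by rewrite /cylinder /= refine_mkseq. Qed.

Definition lower (p : seq S) : R :=
  \sum_(i < size p)
    path_prob sigma s (take i p) * before (step sigma s (take i p)) (nth s p i).

Lemma path_prob_rcons p t :
  path_prob sigma s (rcons p t) = path_prob sigma s p * step sigma s p t.
Proof.
rewrite /path_prob size_rcons big_ord_recr /= -cats1 take_size_cat//.
rewrite nth_cat ltnn subnn /=; congr (_ * _); apply: eq_bigr => i _.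
by rewrite takel_cat ?nth_cat ?ltn_ord// ltnW.
Qed.

Lemma lower_rcons p t : lower (rcons p t) =
  lower p + path_prob sigma s p * before (step sigma s p) t.
Proof.
rewrite /lower size_rcons big_ord_recr /= -cats1 take_size_cat//.
rewrite nth_cat ltnn subnn /=; congr (_ + _); apply: eq_bigr => i _.
by rewrite takel_cat ?nth_cat ?ltn_ord// ltnW.
Qed.

Lemma path_prob_ge0 p : path (trans M) s p -> 0 <= path_prob sigma s p.
Proof.
elim/last_ind: p => [|p t IH]; first by rewrite /path_prob big_ord0.
rewrite rcons_path path_prob_rcons => /andP[sp _].
by rewrite mulr_ge0 ?IH//; have [] := step_distr sp.
Qed.

Lemma refine_interval u p : 0 <= u < 1 -> path (trans M) s p ->
  ((refine u (size p)).1 = p <->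
     lower p <= u < lower p + path_prob sigma s p) /\
  ((refine u (size p)).1 = p ->
     0 < path_prob sigma s p /\
     (refine u (size p)).2 * path_prob sigma s p = u - lower p).
Proof.
move=> u01; elim/last_ind: p => [|p t IH].
  by rewrite /lower /path_prob !big_ord0 /= add0r u01 subr0 mulr1.
rewrite rcons_path => /andP[sp _]; have {IH}[IH1 IH2] := IH sp.
have w0 := path_prob_ge0 sp.
have D := step_distr sp.
have [+ v01] := refineP (size p) u01.
rewrite size_rcons /= lower_rcons path_prob_rcons.
move: IH1 IH2 v01; case: (refine u (size p)) => q v /= IH1 IH2 v01 sq.
set w := path_prob sigma s p in w0 IH1 IH2 *; set f := step sigma s p in D *.
have key : q = p -> (is_next f t v <-> lower p + w * before f t <= u <
    lower p + w * before f t + w * f t).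
  move=> /IH2[wp vw]; rewrite /is_next.
  have -> : u = lower p + w * v by rewrite mulrC vw addrC subrK.
  by rewrite -addrA -mulrDr lerD2l ltrD2l ler_pM2l ?ltr_pM2l.
split; first split.
- move=> /rcons_inj[qp nt]; apply/(key qp); rewrite -nt /f -qp.
  exact: next_stateP.
- move=> I.
  have qp : q = p.
    apply/IH1; have b0 := before_ge0 D t; have b1 := before_le1 D t.
    have wb : 0 <= w * before f t by rewrite mulr_ge0.
    have wb1 : w * (before f t + f t) <= w by rewrite ler_piMr.
    by move: I wb1; rewrite mulrDr; lra.
  have nt := (key qp).2 I.
  have nt' : is_next f (next_state q v) v by rewrite /f -qp; exact: next_stateP.
  by rewrite (is_next_inj D nt' nt) qp.
- move=> /rcons_inj[qp nt]; have [wp vw] := IH2 qp.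
  have nP : is_next f t v by rewrite -nt /f -qp; exact: next_stateP.
  have f0 : 0 < f t by case/andP: nP; lra.
  rewrite mulr_gt0//; split => //.
  have -> : step sigma s q = f by rewrite /f qp.
  rewrite nt [w * f t]mulrC mulrA divfK ?gt_eqF//.
  by rewrite mulrBl vw [before f t * w]mulrC opprD addrA.
Qed.

Lemma lower_itv p : path (trans M) s p ->
  0 <= lower p /\ lower p + path_prob sigma s p <= 1.
Proof.
elim/last_ind: p => [|p t IH].
  by rewrite /lower /path_prob !big_ord0 add0r.
rewrite rcons_path => /andP[sp _]; have {IH}[IH1 IH2] := IH sp.
have D := step_distr sp; have w0 := path_prob_ge0 sp.
have b0 := before_ge0 D t; have b1 := before_le1 D t.
rewrite lower_rcons path_prob_rcons.
split; first by rewrite addr_ge0// mulr_ge0.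
by rewrite -addrA -mulrDr (le_trans _ IH2)// lerD2l ler_piMr.
Qed.

Lemma sample_run_preimage p : path (trans M) s p ->
  sample_run @^-1` cylinder s p `&` `[0, 1[%classic =
  `[lower p, lower p + path_prob sigma s p[%classic.
Proof.
move=> sp; have [l0 l1] := lower_itv sp; apply/seteqP; split => u /=.
  rewrite !in_itv/= => -[/sample_run_cylinder + u01].
  by rewrite /truncate01 u01 => /(refine_interval u01 sp).1.
rewrite !in_itv/= => I; have u01 : 0 <= u < 1 by lra.
split => //; apply/sample_run_cylinder; rewrite /truncate01 u01.
exact/(refine_interval u01 sp).1.
Qed.

Lemma cylinder_invalid p : ~~ path (trans M) s p -> cylinder s p = set0.
Proof.
move=> /negP sp; apply/seteqP; split => // r /= rp; apply: sp; rewrite -rp.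
elim: (size p) => // n IH; rewrite mkseqS rcons_path IH.
suff -> : last s (mkseq (fun i => r i.+1) n) = r n by exact: run_trans.
by case: n {IH} => [|n]; [rewrite run_start|rewrite mkseqS last_rcons].
Qed.

Lemma measurable_sample_run : measurable_fun [set: R] sample_run.
Proof.
apply: (@measurability _ _ _ (run_space s) _ _ (range (cylinder s))) => //.
move=> _ [_ [p _ <-] <-].
rewrite setTI; have [sp|sp] := boolP (path (trans M) s p); last first.
  by rewrite cylinder_invalid// preimage_set0.
rewrite -[X in measurable X](setUIDK _ `[0, 1[%classic).
rewrite sample_run_preimage//; apply: measurableU => //.
have [c0|c0] := pselect (cylinder s p (sample_run 0)).
  rewrite [X in measurable X](_ : _ = ~` `[0, 1[%classic); first exact: measurableC.
  apply/seteqP; split => u /= ; first by case.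
  move=> u01; split => //; move: c0; rewrite !sample_run_cylinder.
  rewrite /truncate01 lexx ltr01; move: u01; rewrite in_itv/=.
  by case: ifP.
rewrite [X in measurable X](_ : _ = set0)//.
apply/seteqP; split => u //= -[+ u01].
move: c0; rewrite !sample_run_cylinder /truncate01 lexx ltr01.
by move: u01; rewrite in_itv/=; case: ifP.
Qed.

Let mu01 : {measure set (measurableTypeR R) -> \bar R} :=
  mrestr (@lebesgue_measure R) (measurable_itv `[0, 1[).
Let mu_run : set (run_space s) -> \bar R := fun C => mu01 (sample_run @^-1` C).

Let msample C : measurable C -> measurable (sample_run @^-1` C).
Proof.
by move=> mC; rewrite -[X in measurable X]setTI; exact: measurable_sample_run.
Qed.

Let mu_run0 : mu_run set0 = 0%E.
Proof. by rewrite /mu_run preimage_set0 measure0. Qed.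

Let mu_run_ge0 C : (0 <= mu_run C)%E.
Proof. exact: measure_ge0. Qed.

Let mu_run_sigma_additive : semi_sigma_additive mu_run.
Proof.
move=> F mF tF mUF; rewrite /mu_run preimage_bigcup.
apply: measure_semi_sigma_additive.
- by move=> n; exact: msample.
- apply/trivIsetP => i j _ _ ij; rewrite -preimage_setI.
  by move/trivIsetP : tF => /(_ _ _ Logic.I Logic.I ij) ->; rewrite preimage_set0.
- by rewrite -preimage_bigcup; exact: msample.
Qed.

HB.instance Definition _ :=
  isMeasure.Build _ _ _ mu_run mu_run0 mu_run_ge0 mu_run_sigma_additive.

Let mu_runT : mu_run setT = 1%E.
Proof.
rewrite /mu_run preimage_setT /mu01 /= /mrestr setTI lebesgue_measure_itv /=.
by rewrite lte_fin ltr01 sube0.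
Qed.

HB.instance Definition _ := Measure_isProbability.Build _ _ _ mu_run mu_runT.

Lemma run_measure_exists :
  exists mu : probability (run_space s) R, is_run_measure sigma mu.
Proof.
exists mu_run => p sp.
transitivity (lebesgue_measure (sample_run @^-1` cylinder s p `&` `[0, 1[)) => //.
rewrite sample_run_preimage//.
rewrite lebesgue_measure_itv /= lte_fin.
case: ltP => [_|]; first by rewrite -EFinB addrC addKr.
rewrite gerDl => w0; congr EFin; apply/eqP.
by rewrite eq_le w0 path_prob_ge0.
Qed.

(* By uniqueness, [is_run_measure] determines the measure of every event. *)
Lemma run_measure_unique (mu nu : probability (run_space s) R) :
  is_run_measure sigma mu -> is_run_measure sigma nu ->
  forall C, measurable C -> mu C = nu C.
Proof.
move=> muP nuP; pose G := [set C : set (run_space s) |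
  C = set0 \/ exists2 p, path (trans M) s p & C = cylinder s p].
apply: (measure_unique G (fun=> setT)).
- apply/seteqP; split; apply: smallest_sub; try exact: smallest_sigma_algebra.
    move=> _ [p _ <-]; apply: sub_sigma_algebra.
    have [sp|/cylinder_invalid ->] := boolP (path (trans M) s p); last by left.
    by right; exists p.
  move=> _ [->|[p _ ->]]; first exact: (@measurable0 _ (run_space s)).
  by apply: sub_sigma_algebra; exists p.
- suff cylI p q : (size p <= size q)%N -> path (trans M) s q ->
      G (cylinder s p `&` cylinder s q).
    move=> B C [->|[p sp ->]]; first by rewrite set0I; left.
    move=> [->|[q sq ->]]; first by rewrite setI0; left.
    have [pq|/ltnW qp] := leqP (size p) (size q); first exact: cylI.
    by rewrite setIC; exact: cylI.
  move=> pq sq; have takeE (r : run s) :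
      take (size p) (mkseq (fun i => r i.+1) (size q)) =
      mkseq (fun i => r i.+1) (size p).
    by rewrite /mkseq -map_take take_iota (minn_idPl pq).
  have [qp|qp] := eqVneq (take (size p) q) p.
    right; exists q => //; apply/setIidPr => r /= rq.
    by rewrite /cylinder /= -[RHS]qp -[in RHS]rq takeE.
  left; apply/seteqP; split => // r [/= rp rq].
  by move/eqP: qp; apply; rewrite -[in LHS]rq takeE.
- move=> _; right; exists [::] => //; apply/seteqP; split => // r _.
- by rewrite bigcup_const.
- move=> _ [->|[p sp ->]]; first by rewrite !measure0.
  exact: etrans (muP p sp) (esym (nuP p sp)).
- move=> _; apply: le_lt_trans (ltry 1).
  exact: (probability_le1 mu measurableT).
Qed.

End run_measure_construction.

Definition run_measure (sigma : strategy) (s : S) :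
  probability (run_space s) R := sval (cid (run_measure_exists sigma s)).

Definition event := forall s : S, set (run_space s).

Definition value (phi : event) (s : S) : \bar R :=
  ereal_sup [set run_measure sigma s (phi s) | sigma in [set: strategy]].

Definition optimal (phi : event) (s : S) (sigma : strategy) :=
  run_measure sigma s (phi s) = value phi s.

Definition GF (A : set (S * S)) : event := fun s =>
  [set r | forall n, exists2 m, (n <= m)%N & A (r m, r m.+1)].

Definition universally_transient :=
  forall (s0 : S) (sigma : strategy),
    {ae run_measure sigma s0, forall r : run s0,
      ~ exists s, forall n, exists2 m, (n <= m)%N & r m = s}.

End runs.

Arguments cylinder {R S} M s p.
Arguments run_measure {R S M} sigma s.
Arguments GF {R S} M A s.

(* Main.v *)
(* A plan k gives the distribution of the next state from the path followed so
   far, from a fixed start state; the objective has probability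
   [inf_i P(some transition of A i is taken at a time >= i)], which is a matter
   of finite-horizon reachability.

   Residuals of optimal plans are optimal, so among the states with an optimal
   plan there are "good" choices, which preserve the value.  When the MDP is
   transient, committing to good choices c on a finite set K costs nothing: play
   c inside K and restart an optimal plan whenever K is left; almost surely there
   are finitely many restarts.  With c committed on K, discounted value iteration
   yields a positional strategy that reaches A i from x with probability at least
   val(x) - eps, and only finitely many of its choices matter.  Committing to
   those and dovetailing over all pairs (x, i) gives in the limit a positional
   good strategy under which every A i is reached from every x with probability
   at least val(x); since it preserves the value, this still holds after any
   number of steps, so it is optimal.

   For the second part, the product with a step counter is always transient, and
   its positional strategies are the Markov strategies of the original MDP. *)

Require Import Defs.
From mathcomp Require Import all_boot all_order all_algebra.
From mathcomp Require Import all_classical all_reals all_analysis.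
From mathcomp Require Import lra.

Set Implicit Arguments.
Unset Strict Implicit.
Unset Printing Implicit Defensive.

Import Order.TTheory GRing.Theory Num.Theory.
Import numFieldNormedType.Exports.

Local Open Scope classical_set_scope.
Local Open Scope ring_scope.

(** * Elementary estimates and a pigeonhole on finite sets *)

Lemma fin_num01 (R : realDomainType) (x : \bar R) : (0 <= x <= 1)%E -> x \is a fin_num.
Proof. by move=> /andP[x0 x1]; rewrite ge0_fin_numE// (le_lt_trans x1)// ltry. Qed.

Lemma bernoulli_ge (R : realFieldType) (d : R) n :
  (0 <= d <= 1)%R -> (1 - n%:R * d <= (1 - d) ^+ n)%R.
Proof.
move=> /andP[d0 d1]; elim: n => [|n IH]; first by rewrite mul0r subr0.
rewrite exprS; apply: (@le_trans _ _ ((1 - d) * (1 - n%:R * d))%R).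
  rewrite -natr1; have : (0 <= n%:R * d * d)%R by rewrite !mulr_ge0.
  by move: (n%:R : R) => m; nra.
by rewrite ler_wpM2l// subr_ge0.
Qed.

(** Bookkeeping for [positional_reach]: [r - e <= p * r <= z + q], so passing from [b] to [r],
    dropping the factor [p] and discarding [q] cost at most [e] each. *)
Lemma discount_error (R : realFieldType) (b r z p q e : R) :
  (b <= r + e)%R -> (p * r <= z + q)%R ->
  (1 - e <= p)%R -> (q <= e)%R -> (0 <= r <= 1)%R -> (0 <= e)%R ->
  (b <= z + (e + e + e))%R.
Proof. by move=> br prz ep qe /andP[r0 r1] e0; nra. Qed.

Lemma infinitely_often_mem (T : eqType) (u : nat -> T) (K : seq T) :
  (forall n, exists2 m, (n <= m)%N & u m \in K) ->
  exists y, forall n, exists2 m, (n <= m)%N & u m = y.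
Proof.
elim: K => [|y K IH] uK; first by have [] := uK 0%N.
have [uy|/existsNP[n0 n0y]] := pselect (forall n, exists2 m, (n <= m)%N & u m = y).
  by exists y.
apply: IH => n; have [m] := uK (maxn n n0); rewrite geq_max inE => /andP[nm n0m].
by case/predU1P => [umy|umK]; [case: n0y|]; exists m.
Qed.

(** * Averages under a mass function on a countable set *)

Section averages.
Context {R : realType} {S : countType}.
Local Open Scope ereal_scope.
Implicit Types (d : S -> R) (f g : S -> \bar R).

Definition pmf d :=
  (forall t, 0 <= d t)%R /\ \esum_(t in [set: S]) (d t)%:E = 1.

Definition dirac_pmf (t : S) : S -> R := fun u => ((u == t)%:R)%R.

(** The sum is a supremum of finite sums, hence an expectation only for terms [>= 0]. The lemmas
    below constrain [f] just where [d] is positive, because residuals of a plan are known to be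
    plans only along transitions. *)
Definition avg d f : \bar R := \esum_(t in [set: S]) ((d t)%:E * f t).

Lemma is_distr_pmf (X : {pred S}) d : is_distr X d -> pmf d.
Proof.
move=> [d0 dX d1]; split => //; rewrite -d1 [RHS]esum_mkcond.
by apply: eq_esum => t _; rewrite mem_setE; case: ifPn => // /dX ->.
Qed.

Lemma is_distr_supp (X : {pred S}) d t : is_distr X d -> (0 < d t)%R -> t \in X.
Proof.
by move=> [_ dX _]; apply: contraTT => /dX ->; rewrite ltxx.
Qed.

Lemma is_distr_dirac (X : {pred S}) t : t \in X -> is_distr X (dirac_pmf t).
Proof.
move=> tX; split => [u|u|]; rewrite /dirac_pmf.
- by case: (u == t).
- by apply: contraNeq; case: (u =P t) => [->|_]; rewrite ?eqxx.
rewrite (esumID [set t]); last by move=> u _; rewrite lee_fin; case: (u == t).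
rewrite [X in X + _](_ : _ = 1).
  rewrite esum1 ?adde0// => u /= [_ /eqP ut].
  by case: (u =P t) => [/eqP|] //; rewrite (negbTE ut).
rewrite [X in \esum_(_ in X) _](_ : _ = [set t]).
  by rewrite esum_set1 eqxx// lee_fin.
by apply/seteqP; split => u /= => [[]|->].
Qed.

Lemma avg_ext d f g : (forall t, 0 <= d t)%R ->
  (forall t, (0 < d t)%R -> f t = g t) -> avg d f = avg d g.
Proof.
move=> d0 fg; apply: eq_esum => t _.
have := d0 t; rewrite le_eqVlt => /predU1P[<-|/fg->//].
by rewrite !mul0e.
Qed.

Lemma avg_term_ge0 d f : (forall t, 0 <= d t)%R ->
  (forall t, (0 < d t)%R -> 0 <= f t) -> forall t, 0 <= (d t)%:E * f t.
Proof.
move=> d0 f0 t; have := d0 t; rewrite le_eqVlt => /predU1P[<-|dt].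
  by rewrite mul0e.
by rewrite mule_ge0// ?f0// lee_fin.
Qed.

Lemma avg_ge0 d f : (forall t, 0 <= d t)%R ->
  (forall t, (0 < d t)%R -> 0 <= f t) -> 0 <= avg d f.
Proof. by move=> d0 f0; apply: esum_ge0 => t _; exact: avg_term_ge0. Qed.

Lemma le_avg d f g : (forall t, 0 <= d t)%R ->
  (forall t, (0 < d t)%R -> f t <= g t) -> avg d f <= avg d g.
Proof.
move=> d0 fg; apply: le_esum => t _.
have := d0 t; rewrite le_eqVlt => /predU1P[<-|dt].
  by rewrite !mul0e.
by rewrite lee_wpmul2l ?lee_fin// fg.
Qed.

Lemma avgD d f g : (forall t, 0 <= d t)%R ->
  (forall t, (0 < d t)%R -> 0 <= f t) -> (forall t, (0 < d t)%R -> 0 <= g t) ->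
  avg d (fun t => f t + g t) = avg d f + avg d g.
Proof.
move=> d0 f0 g0; rewrite /avg -esumD; first last.
- by move=> t _; exact: avg_term_ge0.
- by move=> t _; exact: avg_term_ge0.
apply: eq_esum => t _.
have := d0 t; rewrite le_eqVlt => /predU1P[<-|dt].
  by rewrite !mul0e adde0.
by rewrite ge0_muleDr ?f0 ?g0.
Qed.

Lemma esum_pmulr (c : R) (f : S -> \bar R) : (0 <= c)%R ->
  (forall t, 0 <= f t) ->
  \esum_(t in [set: S]) (c%:E * f t) = c%:E * \esum_(t in [set: S]) f t.
Proof.
move=> c0 f0; rewrite /esum -ereal_supZl//; last first.
  by apply/set0P; exists 0; exists set0; [exact: fsets_set0|rewrite fsbig_set0].
congr ereal_sup; apply/seteqP; split => x /=.
  move=> [X XS <-]; exists (\sum_(t \in X) f t); first by exists X.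
  by rewrite ge0_mule_fsumr.
move=> [_ [X XS <-] <-]; exists X => //.
by rewrite ge0_mule_fsumr.
Qed.

Lemma avgZ d f (c : R) : (forall t, 0 <= d t)%R -> (0 <= c)%R ->
  (forall t, (0 < d t)%R -> 0 <= f t) ->
  avg d (fun t => c%:E * f t) = c%:E * avg d f.
Proof.
move=> d0 c0 f0; rewrite /avg -esum_pmulr//; last exact: avg_term_ge0.
by apply: eq_esum => t _; rewrite muleCA.
Qed.

Lemma avg_cst d (c : \bar R) : pmf d -> 0 <= c -> c \is a fin_num ->
  avg d (fun=> c) = c.
Proof.
move=> [d0 d1] c0 cfin; rewrite -(fineK cfin) /avg -[RHS]mule1 -d1 -esum_pmulr//.
- by apply: eq_esum => t _; rewrite muleC.
- exact: fine_ge0.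
Qed.

Lemma avg_dirac t f : 0 <= f t -> avg (dirac_pmf t) f = f t.
Proof.
move=> ft; rewrite /avg (_ : (fun u => _) =
    (fun u => if u \in [set t] then f t else 0)).
  by rewrite -esum_mkcond esum_set1.
apply/funext => u; rewrite /dirac_pmf; case: ifPn => [/set_mem ->|].
  by rewrite eqxx mul1e.
by rewrite notin_setE => /eqP /negbTE ->; rewrite mul0e.
Qed.

Lemma avg_itv d f : pmf d -> (forall t, (0 < d t)%R -> 0 <= f t <= 1) ->
  0 <= avg d f <= 1.
Proof.
move=> dp f01; have [d0 d1] := dp; apply/andP; split.
  by apply: avg_ge0 => // t /f01/andP[].
rewrite -[leRHS](avg_cst dp)//.
by apply: le_avg => // t /f01/andP[].
Qed.

Lemma avg_fin d f : pmf d -> (forall t, (0 < d t)%R -> 0 <= f t <= 1) ->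
  avg d f \is a fin_num.
Proof. by move=> dp f01; apply: fin_num01; exact: avg_itv. Qed.

Lemma avg_sup d (f : nat -> S -> \bar R) : (forall t, 0 <= d t)%R ->
  (forall n t, (0 < d t)%R -> 0 <= f n t) ->
  (forall m n t, (m <= n)%N -> (0 < d t)%R -> f m t <= f n t) ->
  avg d (fun t => ereal_sup (range (f ^~ t))) =
  ereal_sup (range (fun n => avg d (f n))).
Proof.
move=> d0 f0 fmono; apply/eqP; rewrite eq_le; apply/andP; split; last first.
  apply: ge_ereal_sup => _ [n _ <-]; apply: le_avg => // t _.
  by apply: ereal_sup_ubound; exists n.
apply: ge_ereal_sup => _ [X [finX _] <-].
rewrite fsbig_finite//=.
pose F n := \sum_(t <- finmap.enum_fset (fset_set X)) ((d t)%:E * f n t).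
have Fcvg : F n @[n --> \oo] -->
    \sum_(t <- finmap.enum_fset (fset_set X)) ((d t)%:E * ereal_sup (range (f ^~ t))).
  apply: cvg_nnesum => [t _|t _].
    by apply: nearW => n; apply: avg_term_ge0 => // u; exact: f0.
  have := d0 t; rewrite le_eqVlt => /predU1P[<-|dt].
    rewrite mul0e [X in X @ _](_ : _ = fun=> 0); first exact: cvg_cst.
    by apply/funext => n; rewrite mul0e.
  apply: cvgeZl => //; apply: ereal_nondecreasing_cvgn => m n mn.
  exact: fmono.
rewrite -(cvg_lim _ Fcvg)//; apply: lime_le; first by apply/cvg_ex; eexists; exact: Fcvg.
apply: nearW => n; apply: le_ereal_sup_tmp; exists (avg d (f n)); first by exists n.
apply: esum_ge; exists X => //; rewrite fsbig_finite//=.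
Qed.

(** Monotone convergence from above, by [avg_sup] for the complements [1 - f n]; total mass 1 and
    values in [0, 1] keep all differences finite. *)
Lemma avg_inf d (f : nat -> S -> \bar R) : pmf d ->
  (forall n t, (0 < d t)%R -> 0 <= f n t <= 1) ->
  (forall m n t, (m <= n)%N -> (0 < d t)%R -> f n t <= f m t) ->
  avg d (fun t => ereal_inf (range (f ^~ t))) =
  ereal_inf (range (fun n => avg d (f n))).
Proof.
move=> dp f01 fmono; have [d0 d1] := dp.
apply/eqP; rewrite eq_le; apply/andP; split.
  apply: le_ereal_inf_tmp => _ [n _ <-]; apply: le_avg => // t _.
  by apply: ereal_inf_lbound; exists n.
set I := ereal_inf _.
pose g n t := 1 - f n t.
have g01 n t : (0 < d t)%R -> 0 <= g n t <= 1.
  move=> /f01 => /(_ n) f1; have ff := fin_num01 f1; case/andP: f1 => f0 f1.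
  rewrite /g; apply/andP; split; first by rewrite sube_ge0// ff.
  by rewrite leeBlDl// leeDr.
have gmono m n t : (m <= n)%N -> (0 < d t)%R -> g m t <= g n t.
  by move=> mn dt; rewrite /g leeB// fmono.
have gI n : avg d (g n) <= 1 - I.
  have fI : avg d (f n) + avg d (g n) = 1.
    rewrite -avgD//; [|by move=> t /f01 => /(_ n)/andP[] | by move=> t /g01 => /(_ n)/andP[]].
    rewrite -[RHS](avg_cst dp)//; apply: avg_ext => // t /f01 => /(_ n)/fin_num01 ft.
    by rewrite /g addeC subeK.
  have A1 := fin_num01 (avg_itv dp (f01 n)).
  rewrite (_ : avg d (g n) = 1 - avg d (f n)).
    by rewrite leeB//; apply: ereal_inf_lbound; exists n.
  by rewrite -fI addeAC subee// add0e.
have G1 : avg d (fun t => ereal_sup (range (g ^~ t))) <= 1 - I.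
  rewrite avg_sup//; last by move=> n t /g01 => /(_ n)/andP[].
  by apply: ge_ereal_sup => _ [n _ <-].
have i01 t : (0 < d t)%R -> 0 <= ereal_inf (range (f ^~ t)) <= 1.
  move=> dt; apply/andP; split.
    by apply: le_ereal_inf_tmp => _ [n _ <-]; case/andP: (f01 n t dt).
  apply: ge_ereal_inf; exists (f 0%N t); first by exists 0%N.
  by case/andP: (f01 0%N t dt).
have s01 t : (0 < d t)%R -> 0 <= ereal_sup (range (g ^~ t)) <= 1.
  move=> dt; apply/andP; split; last first.
    by apply: ge_ereal_sup => _ [n _ <-]; case/andP: (g01 n t dt).
  apply: le_ereal_sup_tmp; exists (g 0%N t); first by exists 0%N.
  by case/andP: (g01 0%N t dt).
have sumI : 1 <= avg d (fun t => ereal_inf (range (f ^~ t))) +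
              avg d (fun t => ereal_sup (range (g ^~ t))).
  rewrite -avgD//; [|by move=> t /i01/andP[] | by move=> t /s01/andP[]].
  rewrite -[leLHS](avg_cst dp)//; apply: le_avg => // t dt.
  rewrite -leeBlDr; last exact/fin_num01/s01.
  apply: le_ereal_inf_tmp => _ [n _ <-].
  rewrite leeBlDr; last exact/fin_num01/s01.
  rewrite -leeBlDl; last exact/fin_num01/f01.
  by apply: ereal_sup_ubound; exists n.
have I01 : 0 <= I <= 1.
  apply/andP; split.
    by apply: le_ereal_inf_tmp => _ [n _ <-]; case/andP: (avg_itv dp (f01 n)).
  apply: ge_ereal_inf; exists (avg d (f 0%N)); first by exists 0%N.
  by case/andP: (avg_itv dp (f01 0%N)).
have If := fin_num01 I01.
have := le_trans sumI (leeD2l _ G1); rewrite addeA.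
by rewrite leeBrDl// leeD2rE.
Qed.

(** A strict gap at a point of positive mass would show in the average. This transfers optimality to
    each successor. *)
Lemma avg_eq d f g : pmf d ->
  (forall t, (0 < d t)%R -> 0 <= f t) -> (forall t, (0 < d t)%R -> f t <= g t) ->
  (forall t, (0 < d t)%R -> g t <= 1) -> avg d g <= avg d f ->
  forall t, (0 < d t)%R -> f t = g t.
Proof.
move=> dp f0 fg g1 gf t dt; have [d0 d1] := dp.
have f01 u : (0 < d u)%R -> 0 <= f u <= 1.
  by move=> du; rewrite f0//= (le_trans (fg _ du))// g1.
apply/eqP; rewrite eq_le fg//= leNgt; apply/negP => ftlt.
have gfin : g t \is a fin_num.
  by apply: fin_num01; rewrite g1// andbT; exact: le_trans (f0 _ dt) (fg _ dt).
have ffin := fin_num01 (f01 _ dt).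
pose e u := if u == t then g t - f t else 0.
have e0 u : 0 <= e u by rewrite /e; case: ifP => // _; rewrite sube_ge0 ?ffin// ltW.
have : avg d f + avg d e <= avg d f.
  apply: le_trans gf; rewrite -avgD//; apply: le_avg => // u du.
  rewrite /e; case: eqP => [->|_]; last by rewrite adde0 fg.
  by rewrite addeC subeK.
rewrite -leeBrDl ?subee//; [|exact: (fin_num01 (avg_itv dp f01))..].
apply/negP; rewrite -ltNge.
have : (d t)%:E * e t <= avg d e.
  apply: esum_ge; exists [set t] => //; by rewrite fsbig_set1.
apply: lt_le_trans; rewrite /e eqxx mule_gt0// sube_gt0//.
Qed.

End averages.

(** The total mass is a supremum over finite sets, so a finite one nearly exhausts it. Hence only
    finitely many successors of an infinitely branching random state matter. *)
Lemma pmf_tail (R : realType) (S : countType) (d : S -> R) (e : R) : pmf d -> 0 < e ->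
  exists X : seq S, (avg d (fun t => (t \notin X)%:R%:E) <= e%:E)%E.
Proof.
move=> dp e0; have [d0 d1] := dp.
have : (1 - e%:E < \esum_(t in [set: S]) (d t)%:E)%E.
  by rewrite d1 -EFinB lte_fin ltrBlDr ltrDl.
move=> /ereal_sup_gt[_ [X [finX _] <-]].
rewrite fsbig_finite//=; set s := finmap.enum_fset _ => eX; exists s.
have fin (b : S -> bool) : avg d (fun t => (b t)%:R%:E) \is a fin_num.
  by apply: avg_fin => // t _; case: (b t); rewrite !lee_fin ?lexx ler01.
have : (avg d (fun t => (t \in s)%:R%:E) + avg d (fun t => (t \notin s)%:R%:E) = 1)%E.
  rewrite -avgD//; [|by move=> t _; rewrite lee_fin..].
  rewrite -[RHS](avg_cst dp)//; apply: avg_ext => // t _.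
  by rewrite -EFinD; case: (t \in s); rewrite /= ?addr0 ?add0r.
have : (\sum_(t <- s) (d t)%:E <= avg d (fun t => (t \in s)%:R%:E))%E.
  apply: esum_ge; exists X => //; rewrite fsbig_finite//= -/s.
  rewrite big_seq [leRHS]big_seq; apply: lee_sum => t ts.
  by rewrite ts mule1.
move=> /(lt_le_trans eX).
rewrite -(fineK (fin (fun t => t \in s))) -(fineK (fin (fun t => t \notin s))).
rewrite -EFinB -EFinD lte_fin lee_fin => lt1 [sum1].
by move: lt1 sum1; lra.
Qed.

Lemma measure_bigcup_count (d : measure_display) (T : measurableType d) (R : realType)
    (I : countType) (mu : {measure set T -> \bar R}) (F : I -> set T) :
  (forall i, measurable (F i)) -> trivIset [set: I] F ->
  mu (\bigcup_i F i) = (\esum_(i in [set: I]) mu (F i))%E.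
Proof.
move=> mF tF; pose G j := oapp F set0 (@pickle_inv I j).
have GF i : G (pickle i) = F i by rewrite /G pickleK_inv.
have mG j : measurable (G j) by rewrite /G; case: pickle_inv => /=.
have -> : \bigcup_i F i = \bigcup_j G j.
  apply/seteqP; split => x [i _ Fx]; first by exists (pickle i) => //; rewrite GF.
  by move: Fx; rewrite /G; case: pickle_inv => //= t Ft; exists t.
have tG : trivIset setT G.
  apply/trivIsetP => i j _ _ ij; apply/seteqP; split => // x [].
  rewrite /G; case Ei : pickle_inv => [a|]//=; case Ej : pickle_inv => [b|]//= Fa Fb.
  move/eqP: ij; apply; have := @pickle_invK I i; have := @pickle_invK I j.
  rewrite Ei Ej /= => <- <-; congr pickle.
  by apply: (tF a b) => //; exists x.
rewrite measure_semi_bigcup//; last exact: bigcup_measurable.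
rewrite nneseries_esumT// (esumID (range (@pickle I)))// !setTI.
rewrite [X in (_ + X)%E]esum1 ?adde0; last first.
  move=> j /= jI; rewrite /G; case E : (pickle_inv j) => [t|] /=; last exact: (measure0 mu).
  by case: jI; exists t => //; have := @pickle_invK I j; rewrite E.
rewrite esum_image; last by move=> i j _ _; exact: (pcan_inj pickleK).
by apply: eq_esum => i _; rewrite GF.
Qed.

(** * Plans, finite-horizon reachability and the objective *)

Section plans.
Context {R : realType} {S : countType} (M : mdp R S).
Local Open Scope ereal_scope.
Implicit Types (x y t : S) (k : seq S -> S -> R) (B : set (S * S)).

Definition residual k t : seq S -> S -> R := fun q => k (t :: q).

(** Constrained only along paths of [M] from [x]. Forcing [prob] at random states lets a plan record
    strategic and random moves alike. *)
Definition plan x k := forall q, path (trans M) x q ->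
  is_distr (trans M (last x q)) (k q) /\
  (~~ controlled M (last x q) -> k q = prob M (last x q)).

Lemma plan_distr x k : plan x k -> is_distr (trans M x) (k [::]).
Proof. by move=> /(_ [::] isT)[]. Qed.

Lemma plan_pmf x k : plan x k -> pmf (k [::]).
Proof. by move=> /plan_distr/is_distr_pmf. Qed.

Lemma plan_ge0 x k : plan x k -> forall t, (0 <= k [::] t)%R.
Proof. by move=> /plan_pmf[]. Qed.

Lemma plan_residual x k t : plan x k -> trans M x t -> plan t (residual k t).
Proof. by move=> kP xt q tq; apply: (kP (t :: q)); rewrite /= xt. Qed.

Lemma plan_supp x k t : plan x k -> (0 < k [::] t)%R -> plan t (residual k t).
Proof.
by move=> kP kt; apply: plan_residual (is_distr_supp (plan_distr kP) kt).
Qed.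

Definition taken_or B x (f : S -> \bar R) t : \bar R :=
  if `[< B (x, t) >] then 1 else f t.

(* [reach B N n x k] is the probability that a transition in [B] is taken at a
   time in [[n, N[]. *)
Fixpoint reach B (N n : nat) x k : \bar R :=
  if N is N'.+1 then
    avg (k [::])
      (if n is n'.+1 then fun t => reach B N' n' t (residual k t)
       else taken_or B x (fun t => reach B N' 0 t (residual k t)))
  else 0.

Lemma reachE B N n x k : reach B N.+1 n x k =
  avg (k [::])
    (if n is n'.+1 then fun t => reach B N n' t (residual k t)
     else taken_or B x (fun t => reach B N 0 t (residual k t))).
Proof. by []. Qed.

Lemma taken_or_itv B x f t : 0 <= f t <= 1 -> 0 <= taken_or B x f t <= 1.
Proof. by rewrite /taken_or; case: ifP => // _ _; rewrite lee01 lexx. Qed.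

Lemma taken_orF B x f t : ~ B (x, t) -> taken_or B x f t = f t.
Proof. by move=> nB; rewrite /taken_or asboolF. Qed.

Lemma le_taken_or B x f g t : f t <= g t -> taken_or B x f t <= taken_or B x g t.
Proof. by rewrite /taken_or; case: ifP. Qed.

Lemma reach_itv B N n x k : plan x k -> 0 <= reach B N n x k <= 1.
Proof.
elim: N n x k => [|N IH] n x k kP /=; first by rewrite lexx lee01.
have kp := plan_pmf kP.
case: n => [|n]; apply: avg_itv => // t kt; first apply: taken_or_itv;
  by apply: IH; exact: plan_supp kP kt.
Qed.

Lemma reach_ge0 B N n x k : plan x k -> 0 <= reach B N n x k.
Proof. by move=> /(reach_itv B N n)/andP[]. Qed.

Lemma reach_le1 B N n x k : plan x k -> reach B N n x k <= 1.
Proof. by move=> /(reach_itv B N n)/andP[]. Qed.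

Lemma reach_S B N n x k : plan x k -> reach B N n x k <= reach B N.+1 n x k.
Proof.
elim: N n x k => [|N IH] n x k kP; first exact: reach_ge0.
have k0 := plan_ge0 kP; rewrite [leLHS]/= [leRHS]/=.
case: n => [|n]; apply: le_avg => // t kt; first apply: le_taken_or;
  by apply: IH; exact: plan_supp kP kt.
Qed.

Lemma le_reach B N N' n x k : plan x k -> (N <= N')%N ->
  reach B N n x k <= reach B N' n x k.
Proof.
move=> kP; elim: N' => [|N' IH]; first by rewrite leqn0 => /eqP ->.
rewrite leq_eqVlt => /predU1P[->//|]; rewrite ltnS => /IH/le_trans; apply.
exact: reach_S.
Qed.

Lemma reach_le B N n x k : plan x k -> reach B N n.+1 x k <= reach B N n x k.
Proof.
elim: N n x k => [|N IH] n x k kP //=.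
have k0 := plan_ge0 kP.
case: n => [|n]; apply: le_avg => // t kt; last exact: IH (plan_supp kP kt).
rewrite /taken_or; case: ifP => // _; apply: reach_le1; exact: plan_supp kP kt.
Qed.

Lemma reach_sub B B' N n x k : plan x k -> B `<=` B' ->
  reach B N n x k <= reach B' N n x k.
Proof.
move=> + BB'; elim: N n x k => [|N IH] n x k kP //=.
have k0 := plan_ge0 kP.
case: n => [|n]; apply: le_avg => // t kt; last exact: IH (plan_supp kP kt).
have kt' := plan_supp kP kt.
rewrite /taken_or; case: asboolP => [/BB' xt|_].
  by case: asboolP.
by case: ifP => _; [exact: reach_le1|exact: IH].
Qed.

Definition reach_from B n x k := ereal_sup (range (fun N => reach B N n x k)).

Lemma reach_from_ub B N n x k : reach B N n x k <= reach_from B n x k.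
Proof. by apply: ereal_sup_ubound; exists N. Qed.

Lemma reach_from_itv B n x k : plan x k -> 0 <= reach_from B n x k <= 1.
Proof.
move=> kP; rewrite (le_trans (reach_ge0 B 0 n kP) (reach_from_ub _ _ _ _ _))/=.
by apply: ge_ereal_sup => _ [N _ <-]; exact: reach_le1.
Qed.

Lemma reach_from_le B n x k : plan x k ->
  reach_from B n.+1 x k <= reach_from B n x k.
Proof.
move=> kP; apply: ge_ereal_sup => _ [N _ <-].
exact: le_trans (reach_le _ _ _ kP) (reach_from_ub _ _ _ _ _).
Qed.

Lemma reach_from_leq B n n' x k : plan x k -> (n <= n')%N ->
  reach_from B n' x k <= reach_from B n x k.
Proof.
move=> kP; elim: n' => [|n' IH]; first by rewrite leqn0 => /eqP ->.
rewrite leq_eqVlt => /predU1P[->//|]; rewrite ltnS => /IH; apply: le_trans.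
exact: reach_from_le.
Qed.

Lemma reach_from_sub B B' n x k : plan x k -> B `<=` B' ->
  reach_from B n x k <= reach_from B' n x k.
Proof.
move=> kP BB'; apply: ge_ereal_sup => _ [N _ <-].
exact: le_trans (reach_sub _ _ kP BB') (reach_from_ub _ _ _ _ _).
Qed.

Lemma reach_fromS B n x k : plan x k -> reach_from B n.+1 x k =
  avg (k [::]) (fun t => reach_from B n t (residual k t)).
Proof.
move=> kP; rewrite /reach_from avg_sup.
- apply/eqP; rewrite eq_le; apply/andP; split; apply: ge_ereal_sup => _ [N _ <-].
    apply: le_ereal_sup_tmp; exists (reach B N.+1 n.+1 x k); first by exists N.
    exact: reach_S.
  by apply: ereal_sup_ubound; exists N.+1.
- exact: plan_ge0 kP.
- by move=> N t kt; apply: reach_ge0; exact: plan_supp kP kt.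
- by move=> N N' t NN' kt; apply: le_reach => //; exact: plan_supp kP kt.
Qed.

Section objective.
Variable A : nat -> set (S * S).
Hypothesis A_decr : forall i j, (i <= j)%N -> A j `<=` A i.

Definition win x k := ereal_inf (range (fun i => reach_from (A i) i x k)).

Lemma win_lb i x k : win x k <= reach_from (A i) i x k.
Proof. by apply: ereal_inf_lbound; exists i. Qed.

Lemma win_itv x k : plan x k -> 0 <= win x k <= 1.
Proof.
move=> kP; apply/andP; split.
  by apply: le_ereal_inf_tmp => _ [i _ <-]; case/andP: (reach_from_itv (A i) i kP).
apply: le_trans (win_lb 0 _ _) _.
by case/andP: (reach_from_itv (A 0%N) 0 kP).
Qed.

(** Shifting the level against the time is harmless: [reach_from (A i.+1) i] lies between the terms
    of index [i.+1] and [i] of the infimum. *)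
Lemma winE x k : plan x k ->
  win x k = ereal_inf (range (fun i => reach_from (A i.+1) i x k)).
Proof.
move=> kP; apply/eqP; rewrite eq_le; apply/andP; split;
  apply: le_ereal_inf_tmp => _ [i _ <-].
  exact: le_trans (win_lb i.+1 _ _) (reach_from_le _ _ kP).
apply: ge_ereal_inf; exists (reach_from (A i.+1) i x k); first by exists i.
by apply: reach_from_sub => //; exact: A_decr.
Qed.

Lemma winES x k : plan x k ->
  win x k = ereal_inf (range (fun i => reach_from (A i.+1) i.+1 x k)).
Proof.
move=> kP; apply/eqP; rewrite eq_le; apply/andP; split;
  apply: le_ereal_inf_tmp => _ [i _ <-]; first exact: win_lb.
apply: ge_ereal_inf; exists (reach_from (A i.+1) i.+1 x k); first by exists i.
apply: le_trans (reach_from_le _ _ kP) _.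
by apply: reach_from_sub => //; exact: A_decr.
Qed.

(** The objective is insensitive to the first step: [winES] at [x] and [winE] at the successors use
    the same sets [A i.+1], at times [i.+1] and [i], and [avg_inf] exchanges infimum and average. *)
Lemma win_avg x k : plan x k ->
  win x k = avg (k [::]) (fun t => win t (residual k t)).
Proof.
move=> kP; have k0 := plan_ge0 kP.
rewrite (avg_ext k0 (fun t kt => winE (plan_supp kP kt))) winES//.
rewrite (avg_inf (plan_pmf kP)).
- by apply: (congr1 (fun h => ereal_inf (range h))); apply/funext => i; exact: reach_fromS.
- by move=> i t kt; apply: reach_from_itv; exact: plan_supp kP kt.
- move=> i j t ij kt; have kt' := plan_supp kP kt.
  by apply: le_trans (reach_from_leq _ kt' ij) _; apply: reach_from_sub => //; exact: A_decr.
Qed.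

End objective.
End plans.

(** * Optimal plans and value-preserving choices *)

Section optimality.
Context {R : realType} {S : countType} (M : mdp R S).
Local Open Scope ereal_scope.
Implicit Types (x y t : S) (k : seq S -> S -> R) (B : set (S * S)) (g : S -> S).

Definition positional_plan g x : seq S -> S -> R := fun q =>
  let z := last x q in if controlled M z then dirac_pmf (g z) else prob M z.

Lemma positional_planP g x : (forall y, trans M y (g y)) ->
  plan M x (positional_plan g x).
Proof.
move=> gP q _; rewrite /positional_plan; case: ifPn => cz; split => //.
  by apply: is_distr_dirac; exact: gP.
exact: prob_distr.
Qed.

Variable A : nat -> set (S * S).
Hypothesis A_decr : forall i j, (i <= j)%N -> A j `<=` A i.

Definition best x := ereal_sup [set win A x k | k in plan M x].

Lemma win_best x k : plan M x k -> win A x k <= best x.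
Proof. by move=> kP; apply: ereal_sup_ubound; exists k. Qed.

Lemma exists_plan x : exists k, plan M x k.
Proof.
have [g gP] := choice (trans_total M).
by exists (positional_plan g x); exact: positional_planP.
Qed.

Lemma best_itv x : 0 <= best x <= 1.
Proof.
apply/andP; split.
  have [k kP] := exists_plan x; apply: le_trans (win_best kP).
  by case/andP: (win_itv A kP).
by apply: ge_ereal_sup => _ [k kP <-]; case/andP: (win_itv A kP).
Qed.

Lemma best_fin x : best x \is a fin_num.
Proof. exact: fin_num01 (best_itv x). Qed.

(** The value is superharmonic: moving by [d] and then following an [e]-optimal plan from each
    successor is a plan from [x] that wins with probability at least [avg d best - e]. *)
Lemma avg_best x d : is_distr (trans M x) d ->
  (~~ controlled M x -> d = prob M x) -> avg d best <= best x.
Proof.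
move=> dX dprob; have dp := is_distr_pmf dX; have [d0 _] := dp.
apply/lee_addgt0Pr => e e0.
have /choice[h hP] : forall t, exists k, plan M t k /\ best t <= win A t k + e%:E.
  move=> t; have [_ [k kP <-] ltk] := ub_ereal_sup_adherent e0 (best_fin t).
  by exists k; split => //; rewrite -leeBlDr// ltW.
pose k q := if q is t :: q' then h t q' else d.
have kP : plan M x k.
  move=> [|t q] /=; first by split.
  by move=> /andP[_]; apply: (hP t).1.
apply: le_trans (leeD2r _ (win_best kP)).
rewrite (win_avg A_decr kP) /= -[X in _ + X](avg_cst dp) ?lee_fin ?(ltW e0)//.
rewrite -avgD//.
- by apply: le_avg => // t _; exact: (hP t).2.
- by move=> t _; case/andP: (win_itv A (hP t).1).
- by move=> t _; rewrite lee_fin ltW.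
Qed.

Lemma best_succ x t : controlled M x -> trans M x t -> best t <= best x.
Proof.
move=> cx xt; rewrite -[leLHS](@avg_dirac R); last by case/andP: (best_itv t).
by apply: avg_best; rewrite ?cx//; exact: is_distr_dirac.
Qed.

Definition opt x k := plan M x k /\ win A x k = best x.

(** The win probability of [k] is the average of those of its residuals, which is at most the
    average of [best], itself at most [best x]. Optimality forces equality throughout, and [avg_eq]
    makes it hold at every successor; at a controlled state it applies to [best t <= best x] as
    well. *)
Lemma opt_step x k : opt x k ->
  [/\ forall t, (0 < k [::] t)%R -> opt t (residual k t),
      avg (k [::]) best = best x &
      controlled M x -> forall t, (0 < k [::] t)%R -> best t = best x].
Proof.
move=> [kP wk]; have [kD kprob] := kP [::] isT.
have kp := plan_pmf kP; have [k0 _] := kp.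
have b1 t : best t <= 1 by case/andP: (best_itv t).
have b0 t : 0 <= best t by case/andP: (best_itv t).
have avgb : avg (k [::]) best = best x.
  apply/eqP; rewrite eq_le avg_best//= -wk (win_avg A_decr kP).
  by apply: le_avg => // t kt; apply: win_best; exact: plan_supp kP kt.
split => // [t kt|cx].
  split; first exact: plan_supp kP kt.
  apply: (avg_eq (f := fun t => win A t (residual k t)) kp) => //.
  - by move=> u ku; case/andP: (win_itv A (plan_supp kP ku)).
  - by move=> u ku; apply: win_best; exact: plan_supp kP ku.
  - by rewrite avgb -wk (win_avg A_decr kP).
apply: (avg_eq kp) => // [t kt|]; last by rewrite avgb avg_cst// best_fin.
exact: best_succ (is_distr_supp kD kt).
Qed.

Definition optimizable x := exists k, opt x k.

(* The choices that keep [best], among the states with an optimal plan. *)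
Definition good_choice g := forall y, trans M y (g y) /\
  (controlled M y -> optimizable y -> optimizable (g y) /\ best (g y) = best y).

Lemma opt_succ y : controlled M y -> optimizable y ->
  exists t, [/\ trans M y t, optimizable t & best t = best y].
Proof.
move=> cy [k ok]; have [kP _] := ok; have [ot _ bt] := opt_step ok.
have [t kt] : exists t, (0 < k [::] t)%R.
  apply/not_existsP => H; have [k0 k1] := plan_pmf kP.
  move: k1; rewrite esum1 => [/eqP|t _]; first by rewrite eq_sym onee_eq0.
  by apply/eqP; rewrite eqe eq_le k0 andbT leNgt; exact/negP.
exists t; split; last exact: bt; last by exists (residual k t); exact: ot.
exact: is_distr_supp (plan_distr kP) kt.
Qed.

Lemma exists_good_choice : exists g, good_choice g.
Proof.
suff /choice[g gP] : forall y, exists u, trans M y u /\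
    (controlled M y -> optimizable y -> optimizable u /\ best u = best y).
  by exists g.
move=> y; have [t yt] := trans_total M y.
have [[cy oy]|ncy] := pselect (controlled M y /\ optimizable y).
  by have [u [yu ou bu]] := opt_succ cy oy; exists u; split.
by exists t; split => // cy oy; case: ncy.
Qed.

Lemma exists_opt_plans : exists h : S -> seq S -> S -> R,
  forall x, plan M x (h x) /\ (optimizable x -> opt x (h x)).
Proof.
suff /choice[h hP] : forall x, exists k, plan M x k /\ (optimizable x -> opt x k).
  by exists h.
move=> x.
have [[k ok]|nox] := pselect (optimizable x).
  by exists k; split; first exact: ok.1.
by have [k kP] := exists_plan x; exists k; split.
Qed.

(** At a random state the first move of an optimal plan is [prob] itself, so [opt_step] applies; at
    a controlled one this is what a good choice means. Iterated, it keeps the value along the whole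
    play. *)
Lemma good_choice_harmonic g x : good_choice g -> optimizable x ->
  let d := positional_plan g x [::] in
  (forall t, (0 < d t)%R -> optimizable t) /\ avg d best = best x.
Proof.
move=> gP ox; rewrite /positional_plan /=; case: ifPn => cx.
  have [xg /(_ cx ox)[og bg]] := gP x; split; last first.
    by rewrite avg_dirac; [exact: bg|case/andP: (best_itv (g x))].
  by move=> t; rewrite /dirac_pmf; case: eqP => [->|_]//; rewrite ltxx.
have [k ok] := ox; have [kP _] := ok; have [ot bx _] := opt_step ok.
have [_ /(_ cx) <-] := kP [::] isT.
by split=> // t kt; exists (residual k t); exact: ot.
Qed.

End optimality.

(** * Committing to good choices on a finite set *)

Section freezing.
Context {R : realType} {S : countType} (M : mdp R S).
Local Open Scope ereal_scope.
Implicit Types (x y t : S) (k : seq S -> S -> R) (B : set (S * S)) (g : S -> S).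

Definition leaving (K : seq S) : set (S * S) := [set e | e.1 \in K].

(** A quantitative form of transience: late visits to a finite set are improbable. Taking a
    transition of [leaving K] at some time means being in [K] at that time. *)
Definition transient := forall (K : seq S) x k (e : R), plan M x k -> (0 < e)%R ->
  exists n, reach_from (leaving K) n x k <= e%:E.

Variable A : nat -> set (S * S).
Hypothesis A_decr : forall i j, (i <= j)%N -> A j `<=` A i.

Notation best := (best M A).
Notation opt := (opt M A).
Notation optimizable := (optimizable M A).
Notation good_choice := (good_choice M A).

Variables (K : seq S) (c : S -> S) (h : S -> seq S -> S -> R).

(* Play the choice [c] inside [K], and [k] outside; whenever [K] is left to [t],
   forget the past and start the plan [h t]. *)
Fixpoint frozen k y (q : seq S) : S -> R :=
  if q is t :: q' then frozen (if y \in K then h t else residual k t) t q'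
  else if (y \in K) && controlled M y then dirac_pmf (c y) else k [::].

Hypothesis c_good : good_choice c.
Hypothesis hP : forall x, plan M x (h x) /\ (optimizable x -> opt x (h x)).

Lemma frozenP y k : plan M y k -> plan M y (frozen k y).
Proof.
move=> + q; elim: q y k => [|t q IH] y k kP /=.
  have [kD kprob] := kP [::] isT.
  case: ifPn => [/andP[_ cy] _|_ _]; last by split.
  by split; [apply: is_distr_dirac; have [] := c_good y|rewrite cy].
move=> /andP[yt tq]; apply: IH => //; case: ifP => _; first exact: (hP t).1.
exact: plan_residual kP yt.
Qed.

(** At controlled states of [K] the good choice keeps [best] and leads to an optimizable state;
    elsewhere [opt_step] applies to [k]. Either way the successor is optimizable, so restarting with
    [h] is as good as continuing. *)
Lemma frozen_step y k : opt y k ->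
  let d := frozen k y [::] in
  [/\ forall t, (0 < d t)%R -> opt t (if y \in K then h t else residual k t),
      avg d best = best y &
      controlled M y -> forall t, (0 < d t)%R ->
        best t = best y /\ (y \in K -> t = c y)].
Proof.
move=> ok d; have [kP _] := ok; have [ot bk bc] := opt_step A_decr ok.
have oy : optimizable y by exists k.
rewrite /d /=; case: ifPn => [/andP[yK cy]|].
  rewrite yK; have [yc /(_ cy oy)[oc bcy]] := c_good y.
  have dt t : (0 < dirac_pmf (c y) t :> R)%R -> t = c y.
    by rewrite /dirac_pmf; case: eqP => // _; rewrite ltxx.
  split.
  - by move=> t /dt ->; exact: (hP _).2.
  - by rewrite avg_dirac ?bcy//; case/andP: (best_itv M A y).
  - by move=> _ t /dt ->.
rewrite negb_and => yK; split => //.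
- move=> t kt; case: ifP => _; last exact: ot.
  by apply: (hP t).2; exists (residual k t); exact: ot.
- by move=> cy t kt; split; [exact: bc|move: yK; rewrite cy orbF => /negP].
Qed.

Lemma residual_frozen k y t : residual (frozen k y) t =
  frozen (if y \in K then h t else residual k t) t.
Proof. by []. Qed.

Lemma reach_frozen B N i y k : plan M y k ->
  reach B N i y k <= reach B N i y (frozen k y) + reach (leaving K) N 0 y (frozen k y).
Proof.
elim: N i y k => [|N IH] i y k kP; first by rewrite /= adde0.
have fP := frozenP kP.
have f0 := plan_ge0 fP.
have [yK|yK] := boolP (y \in K).
  apply: le_trans (reach_le1 _ _ _ kP) _.
  rewrite (_ : reach (leaving K) _ _ _ _ = 1).
    by rewrite leeDr// (reach_ge0 _ _ _ fP).
  rewrite /= -[RHS](avg_cst (plan_pmf fP))//; apply: avg_ext => // t _.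
  by rewrite /taken_or; case: asboolP.
have fk : frozen k y [::] = k [::] by rewrite /= (negbTE yK).
have rk t : residual (frozen k y) t = frozen (residual k t) t.
  by rewrite residual_frozen (negbTE yK).
have fPt t : (0 < frozen k y [::] t)%R -> plan M t (frozen (residual k t) t).
  by move=> kt; have := plan_supp fP kt; rewrite rk.
have kPt t : (0 < frozen k y [::] t)%R -> plan M t (residual k t).
  by rewrite fk; exact: (plan_supp kP).
rewrite !reachE -fk.
rewrite -avgD//.
- apply: (le_avg f0) => t kt.
  have nyK : ~ leaving K (y, t) by exact/negP.
  rewrite [X in _ <= _ + X](taken_orF _ nyK).
  have IHt j : reach B N j t (residual k t) <=
      reach B N j t (residual (frozen k y) t) +
      reach (leaving K) N 0 t (residual (frozen k y) t).
    by rewrite rk; apply: IH; exact: kPt.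
  case: i => [|i]; last exact: IHt.
  rewrite /taken_or; case: ifP => _; last exact: IHt.
  by rewrite leeDl// rk (reach_ge0 _ _ _ (fPt _ kt)).
- move=> t kt; have rt := plan_supp fP kt.
  case: i => [|i]; last exact: (reach_ge0 _ _ _ rt).
  by have /andP[] := taken_or_itv B y
    (reach_itv B N 0 rt : 0 <= (fun u => reach B N 0 u (residual (frozen k y) u)) t <= 1).
- move=> t kt; have rt := plan_supp fP kt.
  by have /andP[] := taken_or_itv (leaving K) y (reach_itv (leaving K) N 0 rt :
    0 <= (fun u => reach (leaving K) N 0 u (residual (frozen k y) u)) t <= 1).
Qed.

(** For [n = 0] compare with [k] by [reach_frozen]. After [n] steps the play has kept [best] on
    average and again follows the freezing of an optimal plan, so the comparison made there charges
    only visits to [K] at times [>= n]. *)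
Lemma best_frozen n y k : opt y k ->
  best y <= win A y (frozen k y) + reach_from (leaving K) n y (frozen k y).
Proof.
elim: n y k => [|n IH] y k ok; have [kP wk] := ok; have fP := frozenP kP.
  have rfin := fin_num01 (reach_from_itv (leaving K) 0 fP).
  rewrite -leeBlDr// -wk; apply: le_ereal_inf_tmp => _ [i _ <-].
  rewrite leeBlDr//; apply: le_trans (win_lb A i _ _) _.
  apply: ge_ereal_sup => _ [N _ <-]; apply: le_trans (reach_frozen _ _ _ kP) _.
  by apply: leeD; exact: reach_from_ub.
have [of_ bf _] := frozen_step ok.
have f0 := plan_ge0 fP.
have rP t : (0 < frozen k y [::] t)%R -> plan M t (residual (frozen k y) t).
  by move=> ft; exact: plan_supp fP ft.
rewrite -bf (win_avg A_decr fP) (reach_fromS _ _ fP) -avgD//.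
- by apply: le_avg => // t /of_/IH.
- by move=> t /rP/(win_itv A)/andP[].
- by move=> t /rP/(reach_from_itv (leaving K) n)/andP[].
Qed.

Lemma opt_frozen y k : transient -> opt y k -> opt y (frozen k y).
Proof.
move=> tr ok; have fP := frozenP ok.1; split=> //.
apply/eqP; rewrite eq_le win_best//=; apply/lee_addgt0Pr => e e0.
have [n ne] := tr K _ _ _ fP e0.
by apply: le_trans (best_frozen n ok) _; rewrite leeD2l.
Qed.

End freezing.

(** * Discounted value iteration and greedy positional choices *)

Section greedy.
Context {R : realType} {S : countType} (M : mdp R S).
Local Open Scope ereal_scope.
Implicit Types (x y t : S) (k : seq S -> S -> R) (g : S -> S).

Variable A : nat -> set (S * S).
Hypothesis A_decr : forall i j, (i <= j)%N -> A j `<=` A i.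

Notation best := (best M A).
Notation opt := (opt M A).
Notation optimizable := (optimizable M A).
Notation good_choice := (good_choice M A).

Section discounted.
Variables (K : seq S) (c : S -> S) (h : S -> seq S -> S -> R) (B : set (S * S)).
Variable a : R.
Hypotheses (a_gt0 : (0 < a)%R) (a_lt1 : (a < 1)%R).
Hypothesis c_good : good_choice c.
Hypothesis hP : forall x, plan M x (h x) /\ (optimizable x -> opt x (h x)).

(** Restricting value iteration to these successors makes any greedy choice a good one that agrees
    with [c] on [K]. *)
Definition allowed y : set S :=
  [set t | [/\ trans M y t, optimizable t, best t = best y & y \in K -> t = c y]].

Lemma allowed_choice y : controlled M y -> optimizable y -> allowed y (c y).
Proof. by move=> cy oy; have [yc /(_ cy oy)[]] := c_good y. Qed.

(* Value iteration for reaching [B], discounted by [a ^+ 2]; the greedy choice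
   below gives up one factor [a], so that it need not attain a supremum, and
   the other factor makes its error contract. *)
Fixpoint disc (N : nat) y : \bar R :=
  if N is N'.+1 then
    if controlled M y then
      ereal_sup [set (a ^+ 2)%:E * taken_or B y (disc N') t | t in allowed y]
    else (a ^+ 2)%:E * avg (prob M y) (taken_or B y (disc N'))
  else 0.

Definition disc_lim y := ereal_sup (range (disc ^~ y)).

Let a_ge0 : (0 <= a)%R. Proof. exact: ltW. Qed.
Let a2_ge0 : (0 <= a ^+ 2)%R. Proof. exact: exprn_ge0. Qed.
Let a2_lea : (a ^+ 2 <= a)%R.
Proof. by rewrite expr2 ler_piMl// ltW. Qed.
Let a2_le1 : (a ^+ 2 <= 1)%R.
Proof. by apply: le_trans a2_lea _; exact: ltW. Qed.

Let scale_le1 (b : R) (z : \bar R) :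
  (0 <= b)%R -> (b <= 1)%R -> 0 <= z <= 1 -> 0 <= b%:E * z <= 1.
Proof.
move=> b0 b1 /andP[z0 z1]; rewrite mule_ge0//= -[leRHS]mule1.
by apply: lee_pmul => //; rewrite lee_fin.
Qed.

Lemma optimizable_prob y t : ~~ controlled M y -> optimizable y ->
  (0 < prob M y t)%R -> optimizable t.
Proof.
move=> cy oy; have [ot _] := good_choice_harmonic A_decr c_good oy.
by have := ot t; rewrite /positional_plan /= (negbTE cy).
Qed.

Lemma disc_itv N y : optimizable y -> 0 <= disc N y <= 1.
Proof.
elim: N y => [|N IH] y oy /=; first by rewrite lexx lee01.
case: ifPn => cy; last first.
  apply: scale_le1 => //; apply: avg_itv; first exact: is_distr_pmf (prob_distr cy).
  by move=> t yt; apply: taken_or_itv; apply: IH; exact: optimizable_prob yt.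
have T t : allowed y t -> 0 <= (a ^+ 2)%:E * taken_or B y (disc N) t <= 1.
  by move=> [_ ot _ _]; apply: scale_le1 => //; apply: taken_or_itv; exact: IH.
apply/andP; split; last by apply: ge_ereal_sup => _ [t /T/andP[_ t1] <-].
have ac := allowed_choice cy oy.
apply: le_ereal_sup_tmp; exists ((a ^+ 2)%:E * taken_or B y (disc N) (c y)).
  by exists (c y).
by case/andP: (T _ ac).
Qed.

Lemma disc_lim_itv y : optimizable y -> 0 <= disc_lim y <= 1.
Proof.
move=> oy; apply/andP; split.
  by apply: le_ereal_sup_tmp; exists (disc 0 y); [exists 0%N|].
by apply: ge_ereal_sup => _ [N _ <-]; case/andP: (disc_itv N oy).
Qed.

Lemma reach_disc N y k : opt y k ->
  (a ^+ (2 * N))%:E * reach B N 0 y (frozen M K c h k y) <= disc N y.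
Proof.
elim: N y k => [|N IH] y k ok; first by rewrite /= mule0.
have fP := frozenP K c_good hP ok.1; have f0 := plan_ge0 fP.
have [ft _ fc] := frozen_step A_decr K c_good hP ok.
have fk := plan_distr fP.
have oy : optimizable y by exists k.
set d := frozen M K c h k y [::] in f0 ft fc fk *.
set f := taken_or B y (fun t => reach B N 0 t (residual (frozen M K c h k y) t)).
have rf0 t : (0 < d t)%R -> 0 <= f t.
  move=> dt; have rt := plan_supp fP dt.
  by have /andP[] := taken_or_itv B y (reach_itv B N 0 rt :
    0 <= (fun u => reach B N 0 u (residual (frozen M K c h k y) u)) t <= 1).
have step t : (0 < d t)%R ->
    (a ^+ (2 * N.+1))%:E * f t <= (a ^+ 2)%:E * taken_or B y (disc N) t.
  move=> dt; rewrite mulnS exprD EFinM -muleA lee_wpmul2l ?lee_fin//.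
  rewrite /f /taken_or; case: ifP => _; last exact: IH (ft _ dt).
  by rewrite mule1 lee_fin exprn_ile1// ltW.
rewrite reachE -/d -/f -avgZ ?exprn_ge0//.
have [cy|cy] := boolP (controlled M y).
  have DN := disc_itv N.+1 oy; have /andP[D0 _] := DN.
  rewrite -[leRHS](avg_cst (plan_pmf fP))//; last exact: fin_num01.
  apply: (le_avg f0) => t dt; apply: le_trans (step _ dt) _.
  rewrite /= cy; apply: ereal_sup_ubound; exists t => //; split.
  - exact: is_distr_supp fk dt.
  - by exists (if y \in K then h t else residual k t); exact: ft.
  - by have [] := fc cy t dt.
  - by have [] := fc cy t dt.
have dp : d = prob M y := (fP [::] isT).2 cy.
rewrite /= (negbTE cy) -avgZ ?dp//; rewrite -?dp//.
  exact: le_avg.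
move=> t dt; have /andP[] // : 0 <= taken_or B y (disc N) t <= 1.
by apply: taken_or_itv; apply: disc_itv; exists (if y \in K then h t else residual k t); exact: ft.
Qed.

Lemma disc_lim_ub N y : disc N y <= disc_lim y.
Proof. by apply: ereal_sup_ubound; exists N. Qed.

Let lim_taken_itv y t : optimizable t -> 0 <= taken_or B y disc_lim t <= 1.
Proof. by move=> ot; apply: taken_or_itv; exact: disc_lim_itv. Qed.

Lemma disc_lim_prob y : ~~ controlled M y -> optimizable y ->
  disc_lim y <= a%:E * avg (prob M y) (taken_or B y disc_lim).
Proof.
move=> cy oy; have [p0 _ _] := prob_distr cy.
have av0 : 0 <= avg (prob M y) (taken_or B y disc_lim).
  apply: avg_ge0 => // t /(optimizable_prob cy oy) ot.
  by case/andP: (lim_taken_itv y ot).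
apply: ge_ereal_sup => _ [[|N] _ <-] /=; first by rewrite mule_ge0// lee_fin.
rewrite (negbTE cy); apply: lee_pmul; rewrite ?lee_fin//.
  apply: avg_ge0 => // t /(optimizable_prob cy oy) ot.
  by have /andP[] := taken_or_itv B y (disc_itv N ot).
by apply: le_avg => // t _; apply: le_taken_or; exact: disc_lim_ub.
Qed.

(** If every allowed successor fell short, peeling one factor [a] off each iterate would give
    [disc_lim y <= a * disc_lim y], hence [disc_lim y = 0]; but then [c y] does not fall short. *)
Lemma disc_lim_allowed y : controlled M y -> optimizable y ->
  exists2 t, allowed y t & disc_lim y <= a%:E * taken_or B y disc_lim t.
Proof.
move=> cy oy; have [//|nex] := pselect (exists2 t, allowed y t &
  disc_lim y <= a%:E * taken_or B y disc_lim t).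
have /andP[D0 _] := disc_lim_itv oy.
have lt t : allowed y t -> a%:E * taken_or B y disc_lim t < disc_lim y.
  by move=> yt; rewrite ltNge; apply/negP => le; apply: nex; exists t.
have Dle : disc_lim y <= a%:E * disc_lim y.
  apply: ge_ereal_sup => _ [[|N] _ <-] /=; first by rewrite mule_ge0// lee_fin.
  rewrite cy; apply: ge_ereal_sup => _ [t yt <-].
  rewrite expr2 EFinM -muleA lee_wpmul2l ?lee_fin//.
  apply: le_trans (ltW (lt t yt)); rewrite lee_wpmul2l ?lee_fin//.
  by apply: le_taken_or; exact: disc_lim_ub.
have [D00|Dgt] := eqVneq (disc_lim y) 0.
  have [_ oc _ _] := allowed_choice cy oy.
  have := lt _ (allowed_choice cy oy); rewrite D00 ltNge.
  by case/andP: (lim_taken_itv y oc) => t0 _; rewrite mule_ge0// lee_fin.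
have Df := fin_num01 (disc_lim_itv oy).
move: Dle D0 Dgt; rewrite -(fineK Df) -EFinM !lee_fin eqe => Dle D0 Dgt.
have r0 : (0 < fine (disc_lim y))%R by rewrite lt_neqAle eq_sym Dgt.
by move: Dle; rewrite leNgt gtr_pMl// a_lt1.
Qed.

Lemma exists_greedy : exists g, [/\ good_choice g, {in K, g =1 c} &
  forall y, controlled M y -> optimizable y ->
    disc_lim y <= a%:E * taken_or B y disc_lim (g y)].
Proof.
have /choice[g gP] : forall y, exists t, [/\ y \in K -> t = c y, trans M y t &
    controlled M y -> optimizable y -> [/\ optimizable t, best t = best y &
      disc_lim y <= a%:E * taken_or B y disc_lim t]].
  move=> y; have [[cy oy]|nc] := pselect (controlled M y /\ optimizable y).
    by have [t [yt ot bt tK] le] := disc_lim_allowed cy oy; exists t.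
  by exists (c y); split => //; [case: (c_good y)|move=> cy oy; case: nc].
exists g; split => [y|y yK|y cy oy].
- have [_ yg gc] := gP y; split => // cy oy.
  by have [] := gc cy oy.
- by have [->] := gP y.
- by have [_ _ /(_ cy oy)[]] := gP y.
Qed.

(** Unrolling the greedy inequality along [g], each step keeps a factor [a], which shrinks the
    remainder, at most 1 at first, to [a ^+ N]. *)
Lemma disc_reach g : good_choice g ->
  (forall y, controlled M y -> optimizable y ->
    disc_lim y <= a%:E * taken_or B y disc_lim (g y)) ->
  forall N y, optimizable y ->
  disc_lim y <= reach B N 0 y (positional_plan M g y) + (a ^+ N)%:E.
Proof.
move=> gP gD; elim=> [|N IH] y oy.
  by rewrite /= add0e expr0; case/andP: (disc_lim_itv oy).
have pP x : plan M x (positional_plan M g x).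
  by apply: positional_planP => z; case: (gP z).
have rP t : plan M t (residual (positional_plan M g y) t) := pP t.
have pp := plan_pmf (pP y); have [p0 _] := pp.
have [og _] := good_choice_harmonic A_decr gP oy.
set d := positional_plan M g y [::] in pp p0 og *.
have Dd : disc_lim y <= a%:E * avg d (taken_or B y disc_lim).
  rewrite /d /positional_plan /=; case: ifPn => cy; last exact: disc_lim_prob.
  rewrite avg_dirac; first exact: gD.
  by have [_ /(_ cy oy)[ogy _]] := gP y; case/andP: (lim_taken_itv y ogy).
apply: le_trans Dd _; rewrite reachE.
set f := taken_or B y (fun _ => reach _ _ _ _ _).
have f01 t : (0 < d t)%R -> 0 <= f t <= 1.
  by move=> _; apply: taken_or_itv; exact: reach_itv (rP t).
have f0 t : (0 < d t)%R -> 0 <= f t by move=> /f01/andP[].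
apply: (@le_trans _ _ (a%:E * (avg d f + (a ^+ N)%:E))).
  rewrite lee_wpmul2l ?lee_fin//.
  rewrite -[X in _ <= _ + X](avg_cst pp) ?lee_fin ?exprn_ge0// -avgD//.
    apply: le_avg => // t /og ot; rewrite /f /taken_or.
    by case: ifP => _; [rewrite leeDl// lee_fin exprn_ge0|exact: IH].
  by move=> t _; rewrite lee_fin exprn_ge0.
have af0 : 0 <= avg d f by exact: avg_ge0.
rewrite ge0_muleDr ?lee_fin ?exprn_ge0// -EFinM -exprS leeD2r//.
by rewrite -[leRHS]mul1e lee_wpmul2r// lee_fin ltW.
Qed.

End discounted.

Lemma positional_reach (K : seq S) c x i (e : R) : transient M -> good_choice c ->
  optimizable x -> (0 < e)%R ->
  exists g N, [/\ good_choice g, {in K, g =1 c} &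
    best x <= reach (A i) N 0 x (positional_plan M g x) + e%:E].
Proof.
move=> tr c_good [k ok] e0.
have [h hP] := exists_opt_plans M A.
have [fP fw] := opt_frozen A_decr K c_good hP tr ok.
set fr := frozen M K c h k x in fP fw.
(* Three losses of [e / 3]: cutting at horizon [N], the discount over [N] steps, and the remainder
   [a ^+ n]. *)
pose e1 := (e / 3)%R; have e10 : (0 < e1)%R by rewrite divr_gt0.
have rfin := fin_num01 (reach_from_itv (A i) 0 fP).
have [_ [N _ <-] ltN] := ub_ereal_sup_adherent e10 rfin.
have bN : best x <= reach (A i) N 0 x fr + e1%:E.
  rewrite -leeBlDr//; apply: le_trans (ltW ltN); apply: leeB => //.
  rewrite -fw; apply: le_trans (win_lb A i x fr) _; exact: reach_from_leq fP _.
(* By Bernoulli, [(1 - d) ^+ (2 * N)] is at least [1 - 2 * N * d], hence at least [1 - e1]. The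
   [.+1] keeps the denominator positive, and the cap [1 / 2] puts [a] in ]0, 1[. *)
pose d : R := Num.min (1 / 2)%R (e1 / (2 * N).+1%:R)%R.
have d0 : (0 < d)%R by rewrite lt_min !divr_gt0.
have d12 : (d <= 1 / 2)%R by rewrite ge_min lexx.
have dN : ((2 * N)%:R * d <= e1)%R.
  apply: (@le_trans _ _ ((2 * N).+1%:R * d)%R).
    by rewrite ler_wpM2r ?(ltW d0)// ler_nat.
  by rewrite mulrC -ler_pdivlMr// ge_min lexx orbT.
pose a := (1 - d)%R.
have a0 : (0 < a)%R by rewrite /a; lra.
have a1 : (a < 1)%R by rewrite /a; lra.
have aN : (1 - e1 <= a ^+ (2 * N))%R.
  by apply: le_trans (bernoulli_ge _ _); [lra|lra].
have rd := reach_disc K (A i) a0 a1 c_good hP N ok.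
have [g [gP gK gD]] := exists_greedy K (A i) a0 a1 c_good.
have [n an] : exists n, (a ^+ n <= e1)%R.
  have /cvgrPdist_lt/(_ _ e10)[n _ /(_ n (leqnn n))]  : (a ^+ n)%R @[n --> \oo] --> (0 : R)%R.
    by apply: cvg_expr; rewrite ger0_norm// ltW.
  by rewrite /= sub0r normrN => /(le_lt_trans (ler_norm _))/ltW; exists n.
exists g, n; split => //.
have ox : optimizable x by exists k.
have := disc_reach a0 a1 c_good gP gD n ox.
set z := reach _ n _ _ _ => Dz.
have /andP[N0 N1] := reach_itv (A i) N 0 fP.
have pP : plan M x (positional_plan M g x).
  by apply: positional_planP => y; case: (gP y).
have := le_trans (le_trans rd (disc_lim_ub K c (A i) a N x)) Dz.
move: bN; rewrite -/fr.
have Nf := fin_num01 (reach_itv (A i) N 0 fP).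
have zf : z \is a fin_num := fin_num01 (reach_itv (A i) n 0 pP).
move: N0 N1; rewrite -(fineK Nf) -(fineK zf) -(fineK (best_fin M A x)).
rewrite -!EFinD -EFinM !lee_fin.
move: (fine _) (fine _) (fine _) => rz b rN rN0 rN1 bN Nz.
have -> : e = (e1 + e1 + e1)%R by rewrite /e1; lra.
by apply: discount_error bN Nz aN an _ _; rewrite ?rN0 ?(ltW e10).
Qed.

End greedy.

(** * The positional strategy as a limit of finite commitments *)

Section limit.
Context {R : realType} {S : countType} (M : mdp R S).
Local Open Scope ereal_scope.
Implicit Types (x y t : S) (k : seq S -> S -> R) (g : S -> S).

(** Play under [g] branches only at random states. There finitely many successors carry all mass but
    [e / 2], and the other [e / 2] is the error allowed at each of them in the recursion. *)
Lemma reach_local B g N y (e : R) : (forall z, trans M z (g z)) -> (0 < e)%R ->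
  exists F : seq S, forall g', (forall z, trans M z (g' z)) -> {in F, g' =1 g} ->
    reach B N 0 y (positional_plan M g y) <=
    reach B N 0 y (positional_plan M g' y) + e%:E.
Proof.
move=> gP; elim: N y e => [|N IH] y e e0.
  by exists [::] => g' _ _; rewrite /= add0e lee_fin ltW.
have ri g' (g'P : forall z, trans M z (g' z)) t :
    0 <= reach B N 0 t (positional_plan M g' t) <= 1.
  by apply: reach_itv; exact: positional_planP.
have ti h (hP : forall z, trans M z (h z)) t : 0 <= taken_or B y
    (fun t => reach B N 0 t (positional_plan M h t)) t <= 1.
  by apply: taken_or_itv; exact: ri.
have [cy|cy] := boolP (controlled M y).
  have [F FP] := IH (g y) e e0; exists (y :: F) => g' g'P gg'.
  have g'F : {in F, g' =1 g} by move=> z zF; apply: gg'; rewrite inE zF orbT.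
  have g'y : g' y = g y by apply: gg'; rewrite mem_head.
  rewrite !reachE /positional_plan /= cy g'y.
  rewrite !avg_dirac; [|by case/andP: (ti _ g'P (g y))|by case/andP: (ti _ gP (g y))].
  rewrite /taken_or; case: ifP => _; last exact: FP.
  by rewrite leeDl// lee_fin ltW.
have yD := is_distr_pmf (prob_distr cy); have [p0 _] := yD.
have e20 : (0 < e / 2)%R by rewrite divr_gt0.
have [X XP] := pmf_tail yD e20.
have /choice[F FP] := fun t => IH t _ e20.
exists (flatten [seq F t | t <- X]) => g' g'P gg'.
rewrite !reachE /positional_plan /= (negbTE cy).
set f := taken_or _ _ _; set f' := taken_or _ _ _.
have f'01 t : 0 <= f' t <= 1 := ti g' g'P t.
have f01 t : 0 <= f t <= 1 := ti g gP t.
have ff' t : f t <= f' t + ((e / 2)%:E + (t \notin X)%:R%:E).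
  have [tX|tX] := boolP (t \in X); rewrite /= ?adde0.
    have gg't : {in F t, g' =1 g}.
      by move=> z zF; apply: gg'; apply/flatten_mapP; exists t.
    rewrite /f /f' /taken_or; case: ifP => _; last exact: FP.
    by rewrite leeDl// lee_fin ltW.
  have /andP[f'0 _] := f'01 t; have /andP[_ f1] := f01 t.
  by rewrite (le_trans f1)// addeA leeDr// adde_ge0// lee_fin ltW.
apply: (le_trans (le_avg p0 (fun t _ => ff' t))).
rewrite avgD//.
- rewrite leeD2l// avgD//; [|by move=> t _; rewrite lee_fin ?(ltW e20)..].
  rewrite avg_cst// ?lee_fin ?(ltW e20)//.
  by rewrite [in leRHS](splitr e) EFinD leeD2l.
- by move=> t _; case/andP: (f'01 t).
- by move=> t _; rewrite adde_ge0// lee_fin ltW.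
Qed.

Variable A : nat -> set (S * S).
Hypothesis A_decr : forall i j, (i <= j)%N -> A j `<=` A i.

Notation best := (best M A).
Notation optimizable := (optimizable M A).
Notation good_choice := (good_choice M A).

Hypothesis M_transient : transient M.

(* Freezing [c] on [K'] secures the reachability of [A i] from [x] up to an
   error, whatever is chosen outside [K']. *)
Definition secured (K' : seq S) c x i :=
  optimizable x -> forall g, (forall z, trans M z (g z)) -> {in K', g =1 c} ->
  best x <= reach_from (A i) 0 x (positional_plan M g x) + (i.+1%:R^-1)%:E.

(** Half of the error pays for the positional choice, half for keeping only finitely many of its
    values. [x] joins [K'] so that its own choice is settled too. *)
Lemma secure (K : seq S) c x i : good_choice c ->
  exists K' c', [/\ good_choice c', {subset K <= K'}, {in K, c' =1 c}, x \in K' &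
    secured K' c' x i].
Proof.
move=> cP; have [ox|nox] := pselect (optimizable x); last first.
  exists (x :: K), c; split => //; last by rewrite mem_head.
  by move=> y yK; rewrite inE yK orbT.
pose e : R := (i.+1%:R^-1)%R; have e0 : (0 < e / 2)%R by rewrite divr_gt0// invr_gt0.
have [c' [N [c'P c'K c'N]]] := positional_reach A_decr K i M_transient cP ox e0.
have [F FP] := reach_local (A i) N x (fun z => (c'P z).1) e0.
exists (x :: K ++ F), c'; split => //.
- by move=> y yK; rewrite inE mem_cat yK orbT.
- by rewrite mem_head.
move=> _ g gP gc'; apply: le_trans c'N _.
rewrite -/e [in leRHS](splitr e) EFinD addeA leeD2r//.
apply: (le_trans (FP g gP _)); last by rewrite leeD2r// reach_from_ub.
by move=> z zF; apply: gc'; rewrite inE mem_cat zF !orbT.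
Qed.

Lemma positional_best : exists g, (forall y, trans M y (g y)) /\
  forall x, optimizable x -> win A x (positional_plan M g x) = best x.
Proof.
have [c0 c0P] := exists_good_choice M A_decr.
(* Stage [j] secures the pair [(x, i)] coded by [j], so every pair gets its turn; the finite set
   only grows, and choices on it never change again. *)
pose stage (j : nat) (p q : seq S * (S -> S)) := good_choice p.2 ->
  [/\ good_choice q.2, {subset p.1 <= q.1}, {in p.1, q.2 =1 p.2} &
    forall x i, unpickle j = Some (x, i) -> x \in q.1 /\ secured q.1 q.2 x i].
have /choice[next nextP] : forall jp : nat * (seq S * (S -> S)), exists q, stage jp.1 jp.2 q.
  move=> [j [K c]]; have [cP|ncP] := pselect (good_choice c); last first.
    by exists (K, c) => /ncP.
  case E : (unpickle j : option (S * nat)) => [[x i]|]; last first.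
    by exists (K, c) => _; split => // x i; rewrite E.
  have [K' [c' [? ? ? ? ?]]] := secure K x i cP.
  by exists (K', c') => _; split => // y l; rewrite E => -[<- <-].
pose st := fix st j := if j is j'.+1 then next (j', st j') else ([::], c0).
pose K j := (st j).1; pose c j := (st j).2.
have cP j : good_choice (c j).
  by elim: j => // j IH; have [] := nextP (j, st j) IH.
have cS j : {in K j, c j.+1 =1 c j} by have [] := nextP (j, st j) (cP j).
have KS j : {subset K j <= K j.+1} by have [] := nextP (j, st j) (cP j).
have Kc j n : {subset K j <= K (j + n)%N} /\ {in K j, c (j + n)%N =1 c j}.
  elim: n => [|n [IHK IHc]]; first by rewrite addn0; split.
  rewrite addnS; split=> y yK; first by apply: KS; exact: IHK.
  by rewrite cS; [exact: IHc|exact: IHK].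
have cE j l y : y \in K j -> y \in K l -> c j y = c l y.
  wlog jl : j l / (j <= l)%N.
    by move=> H yj yl; case: (leqP j l) => [|/ltnW] jl; [|symmetry]; exact: H.
  by move=> yj _; rewrite -(subnKC jl) (Kc j _).2.
(* Stage [pickle (y, 0)] puts [y] into the finite set, so its choice is final from the next index
   on. *)
pose g y := c (pickle (y, 0%N)).+1 y.
have secP (x : S) (i : nat) : x \in K (pickle (x, i)).+1 /\
    secured (K (pickle (x, i)).+1) (c (pickle (x, i)).+1) x i.
  have [_ _ _ H] := nextP (pickle (x, i), st (pickle (x, i))) (cP _).
  by apply: H; rewrite pickleK.
have gc j : {in K j, g =1 c j}.
  by move=> y yK; apply: cE => //; have [] := secP y 0%N.
have gP : good_choice g by move=> y; exact: cP.
have gT y : trans M y (g y) by case: (gP y).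
exists g; split => // x ox.
have pP y : plan M y (positional_plan M g y) by exact: positional_planP.
(* Bounds secured for large [l] have small error, and [A l] is included in [A i], so for [A i] the
   error vanishes. *)
have reach0 i y : optimizable y -> best y <= reach_from (A i) 0 y (positional_plan M g y).
  move=> oy; apply/lee_addgt0Pr => e e0.
  pose l := maxn i (Num.bound e^-1).
  have [_ /(_ oy g gT (gc _))] := secP y l; move=> /le_trans; apply.
  apply: leeD.
    by apply: reach_from_sub => //; apply: A_decr; exact: leq_maxl.
  rewrite lee_fin -[leRHS]invrK lef_pV2 ?posrE ?invr_gt0//.
  have := archi_boundP (ltW (eqbRL (invr_gt0 e) e0)).
  move=> /ltW/le_trans; apply; rewrite ler_nat.
  by rewrite (leq_trans (leq_maxr i _)).
apply/eqP; rewrite eq_le win_best//=.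
apply: le_ereal_inf_tmp => _ [i _ <-].
(* Only the time is generalized, the set [A i] stays: [best] is harmonic along [g], so the bound at
   time 0 carries over to every time. *)
elim: {2}i x ox => [|n IH] x ox; first exact: reach0.
have [og <-] := good_choice_harmonic A_decr gP ox.
rewrite (reach_fromS _ _ (pP x)); apply: le_avg; first exact: plan_ge0 (pP x).
by move=> t /og/IH.
Qed.

End limit.

(** * Reachability events under the measure on runs *)

Section run_events.
Context {R : realType} {S : countType} (M : mdp R S) (s : S).
Local Open Scope ereal_scope.
Implicit Types (p : seq S) (B : set (S * S)).

Lemma measurable_cylinder p : measurable (cylinder M s p : set (run_space M s)).
Proof. by apply: sub_sigma_algebra; exists p. Qed.

Lemma cylinder_rcons p t (r : run M s) :
  cylinder M s (rcons p t) r <-> cylinder M s p r /\ r (size p).+1 = t.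
Proof.
rewrite /cylinder /= size_rcons mkseqS; split => [/rcons_inj[]//|[-> ->]//].
Qed.

Lemma cylinder_last p (r : run M s) : cylinder M s p r -> r (size p) = last s p.
Proof.
rewrite /cylinder /=; elim/last_ind: p => [_|p t _]; first exact: run_start.
by rewrite size_rcons mkseqS last_rcons => /rcons_inj[].
Qed.

Definition taken B (n N : nat) : set (run_space M s) :=
  [set r : run M s | exists2 m, (n <= m < N)%N & B (r m, r m.+1)].

Definition taken_from B (n : nat) : set (run_space M s) :=
  [set r : run M s | exists2 m, (n <= m)%N & B (r m, r m.+1)].

(** The event depends only on the states up to time [m.+1], so it is a countable union of cylinders;
    paths of other lengths contribute [set0]. *)
Lemma measurable_step B m :
  measurable ([set r : run M s | B (r m, r m.+1)] : set (run_space M s)).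
Proof.
pose F (p : seq S) : set (run_space M s) :=
  if `[< size p = m.+1 /\ B (nth s (s :: p) m, nth s (s :: p) m.+1) >]
  then cylinder M s p else set0.
rewrite (_ : [set _ | _] = \bigcup_p F p).
  apply: countable_bigcupT_measurable => // p; rewrite /F.
  by case: ifP => _ //; exact: measurable_cylinder.
have rE (r : run M s) i : (i <= m.+1)%N ->
    nth s (s :: mkseq (fun i => r i.+1) m.+1) i = r i.
  by case: i => [|i im] /=; [rewrite run_start|rewrite nth_mkseq].
apply/seteqP; split => [r /= Br|r [p _]].
  exists (mkseq (fun i => r i.+1) m.+1) => //; rewrite /F size_mkseq asboolT.
    by rewrite /cylinder /mkseq /= size_map size_iota.
  by split => //; rewrite !rE.
rewrite /F; case: asboolP => // -[pm Bp] rp /=.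
by move: Bp; rewrite -rp pm !rE.
Qed.

Lemma measurable_taken B n N : measurable (taken B n N).
Proof.
rewrite (_ : taken B n N =
    \bigcup_(m in [set m | (n <= m < N)%N]) [set r : run M s | B (r m, r m.+1)]).
  by apply: bigcup_measurable => m _; exact: measurable_step.
by apply/seteqP; split => r [m]; exists m.
Qed.

Lemma taken_fromE B n : taken_from B n = \bigcup_N taken B n N.
Proof.
apply/seteqP; split => [r [m nm Bm]|r [N _ [m /andP[nm _] Bm]]].
  by exists m.+1 => //; exists m; rewrite ?nm ?ltnSn.
by exists m.
Qed.

Lemma measurable_taken_from B n : measurable (taken_from B n).
Proof.
by rewrite taken_fromE; apply: bigcup_measurable => N _; exact: measurable_taken.
Qed.

Variable sigma : strategy M.
Let P := run_measure sigma s.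

Lemma step_plan : plan M s (step sigma s).
Proof.
move=> q sq; split; first exact: step_distr.
by move=> ncq; rewrite /step insubF//= sq (negbTE ncq).
Qed.

Lemma run_measure_cylinder p : path (trans M) s p ->
  P (cylinder M s p) = (path_prob sigma s p)%:E.
Proof. exact: (svalP (cid (run_measure_exists sigma s))). Qed.

(** Induction on the horizon, splitting the cylinder by the next state. Given [p], the rest of the
    run is governed by the plan that sends [q] to [step sigma s (p ++ q)], with times shifted by
    [size p]. *)
Lemma run_measure_taken_cylinder B N n p : path (trans M) s p ->
  P (cylinder M s p `&` taken B (n + size p) (N + size p)) =
  (path_prob sigma s p)%:E * reach B N n (last s p) (fun q => step sigma s (p ++ q)).
Proof.
elim: N n p => [|N IH] n p sp.
  rewrite [X in P X](_ : _ = set0) ?measure0 ?mule0//.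
  apply/seteqP; split => // r [_ [m /andP[nm mp] _]].
  by move: (leq_ltn_trans nm mp); rewrite add0n ltnNge leq_addl.
have pp0 := path_prob_ge0 sigma sp.
have [d0 dX _] := step_distr sigma sp.
have kP : plan M (last s p) (fun q => step sigma s (p ++ q)).
  move=> q pq; have := step_plan (q := p ++ q); rewrite cat_path sp last_cat; exact.
pose E : set (run_space M s) := taken B (n + size p) (N.+1 + size p).
pose g t := if n is n'.+1 then reach B N n' t (fun q => step sigma s (p ++ t :: q))
  else taken_or B (last s p) (fun t => reach B N 0 t (fun q => step sigma s (p ++ t :: q))) t.
have decomp : cylinder M s p `&` E = \bigcup_t (cylinder M s (rcons p t) `&` E).
  apply/seteqP; split => [r [rp Er]|r [t _ [/cylinder_rcons[rp _] Er]]//].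
  by exists (r (size p).+1) => //; split => //; apply/cylinder_rcons.
rewrite -/E decomp measure_bigcup_count; last 2 first.
- move=> t; apply: measurableI; [exact: measurable_cylinder|exact: measurable_taken].
- move=> t t' _ _ [r [[/cylinder_rcons[_ <-] _] [/cylinder_rcons[_ <-] _]]].
  by [].
have term t : P (cylinder M s (rcons p t) `&` E) =
    (path_prob sigma s p)%:E * ((step sigma s p t)%:E * g t).
  have [pt|npt] := boolP (trans M (last s p) t); last first.
    rewrite dX// mul0e mule0 cylinder_invalid ?set0I ?measure0//.
    by rewrite rcons_path sp.
  have spt : path (trans M) s (rcons p t) by rewrite rcons_path sp.
  have IHt n' : P (cylinder M s (rcons p t) `&` taken B (n' + size p).+1 (N.+1 + size p)) =
      (path_prob sigma s p)%:E * ((step sigma s p t)%:E *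
      reach B N n' t (fun q => step sigma s (p ++ t :: q))).
    have := IH n' _ spt; rewrite size_rcons addnS addSnnS => ->.
    rewrite path_prob_rcons last_rcons EFinM muleA; congr (_ * reach _ _ _ _ _).
    by apply/funext => q; rewrite cat_rcons.
  rewrite /E /g; case: n @E decomp g => [|n'] E decomp g; last by rewrite IHt.
  rewrite /taken_or add0n; case: asboolP => Bt.
    rewrite (_ : _ `&` _ = cylinder M s (rcons p t)); last first.
      apply/setIidPl => r /cylinder_rcons[rp rt]; exists (size p).
        by rewrite leqnn addSn ltnS leq_addl.
      by rewrite (cylinder_last rp) rt.
    by rewrite run_measure_cylinder// path_prob_rcons mule1 EFinM.
  (* The transition at time [size p] is not in [B], so the window may start one step later. *)
  rewrite -IHt add0n; congr (P _); apply/seteqP; split => r [rpt [m mE Bm]];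
    split => //; exists m => //; case/andP: mE => pm mN; rewrite mN andbT; last exact: ltnW.
  rewrite ltn_neqAle pm andbT; apply/eqP => mp; apply: Bt; move: Bm; rewrite -mp.
  by case/cylinder_rcons: rpt => rp <-; rewrite (cylinder_last rp).
rewrite (eq_esum (fun t _ => term t)) esum_pmulr//.
  rewrite reachE cats0 /avg; congr (_ * _); apply: eq_esum => t _; congr (_ * _).
  by rewrite /g; case: (n).
apply: avg_term_ge0 => // t dt.
have pt : trans M (last s p) t := is_distr_supp (step_distr sigma sp) dt.
have rt := plan_residual kP pt.
rewrite /g; case: (n) => [|n']; last exact: (reach_ge0 _ _ _ rt).
rewrite /taken_or; case: ifP => _; [exact: lee01|exact: (reach_ge0 _ _ _ rt)].
Qed.

Lemma run_measure_taken B n N : P (taken B n N) = reach B N n s (step sigma s).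
Proof.
have := @run_measure_taken_cylinder B N n [::] isT.
rewrite !addn0 /path_prob big_ord0 mul1e => <-; congr (P _).
by apply/esym/setIidPr => r _.
Qed.

Lemma run_measure_taken_from B n :
  P (taken_from B n) = reach_from B n s (step sigma s).
Proof.
have mono : nondecreasing_seq (taken B n).
  move=> N N' NN'; apply/subsetPset => r [m /andP[nm mN] Bm].
  by exists m => //; rewrite nm (leq_trans mN).
have mF : measurable (\bigcup_N taken B n N).
  by rewrite -taken_fromE; exact: measurable_taken_from.
have := nondecreasing_cvg_mu (mu := P) (measurable_taken B n) mF mono.
rewrite -taken_fromE => /cvg_lim <- //.
rewrite (_ : P \o taken B n = fun N => reach B N n s (step sigma s)).
  apply/cvg_lim => //; apply: ereal_nondecreasing_cvgn => N N' NN'.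
  exact: le_reach step_plan _.
by apply/funext => N; exact: run_measure_taken.
Qed.

Lemma run_measure_bigcap_taken (B : nat -> set (S * S)) :
  (forall i j, (i <= j)%N -> B j `<=` B i) ->
  P (\bigcap_i taken_from (B i) i) =
  ereal_inf (range (fun i => reach_from (B i) i s (step sigma s))).
Proof.
move=> Bdecr; have mB i := measurable_taken_from (B i) i.
have mono : nonincreasing_seq (fun i => taken_from (B i) i).
  move=> i j ij; apply/subsetPset => r [m jm Bm].
  by exists m; [exact: leq_trans jm|exact: Bdecr Bm].
have fin : P (taken_from (B 0%N) 0) < +oo.
  exact: le_lt_trans (probability_le1 P (mB 0%N)) (ltry _).
have mI : measurable (\bigcap_i taken_from (B i) i) by exact: bigcapT_measurable.
have := nonincreasing_cvg_mu (mu := P) (F := fun i => taken_from (B i) i) fin mB mI mono.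
move=> /cvg_lim <- //.
rewrite (_ : P \o _ = fun i => reach_from (B i) i s (step sigma s)); last first.
  by apply/funext => i; exact: run_measure_taken_from.
apply/cvg_lim => //; apply: ereal_nonincreasing_cvgn => i j ij.
apply: le_trans (reach_from_leq _ step_plan ij) _.
by apply: reach_from_sub; [exact: step_plan|exact: Bdecr].
Qed.

End run_events.

Arguments taken_from {R S} M s B n.

(** * Correspondence between strategies and plans *)

Section plans_of_strategies.
Context {R : realType} {S : countType} (M : mdp R S).
Local Open Scope ereal_scope.

Lemma reach_ext B N n x k k' : plan M x k ->
  (forall q, path (trans M) x q -> k q = k' q) ->
  reach B N n x k = reach B N n x k'.
Proof.
elim: N n x k k' => [//|N IH] n x k k' kP kk'.
rewrite !reachE -(kk' [::])//; have k0 := plan_ge0 kP.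
have rE t j : (0 < k [::] t)%R ->
    reach B N j t (residual k t) = reach B N j t (residual k' t).
  move=> kt; apply: IH (plan_supp kP kt) _ => q tq; apply: kk'.
  by rewrite /= tq andbT; exact: (is_distr_supp (plan_distr kP) kt).
case: n => [|n]; apply: avg_ext => // t kt; last exact: rE.
by rewrite /taken_or; case: ifP => // _; exact: rE.
Qed.

Lemma reach_from_ext B n x k k' : plan M x k ->
  (forall q, path (trans M) x q -> k q = k' q) ->
  reach_from B n x k = reach_from B n x k'.
Proof.
move=> kP kk'; apply: (congr1 (fun h => ereal_sup (range h))).
by apply/funext => N; exact: reach_ext kP kk'.
Qed.

Lemma win_ext A x k k' : plan M x k ->
  (forall q, path (trans M) x q -> k q = k' q) -> win A x k = win A x k'.
Proof.
move=> kP kk'; apply: (congr1 (fun h => ereal_inf (range h))).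
by apply/funext => i; exact: reach_from_ext kP kk'.
Qed.

(** Histories from other start states do not matter for runs from [x]; any successor will do
    there. *)
Lemma plan_strategy x k : plan M x k ->
  exists sigma : strategy M, forall q, path (trans M) x q -> step sigma x q = k q.
Proof.
move=> kP; have [g gP] := choice (trans_total M).
pose f (h : history M) := if (hist_path h).1 == x then k (hist_path h).2
  else dirac_pmf (g (hist_last h)).
have fP h : is_distr (trans M (hist_last h)) (f h).
  rewrite /f /hist_last; case: eqP => [hx|_]; last by apply: is_distr_dirac; exact: gP.
  have /andP[+ _] := hist_valid h; rewrite hx => hq.
  by have [] := kP _ hq.
exists (Strategy fP) => q xq; rewrite /step; case: insubP => [h _ hE|].
  by rewrite /= /f hE /= eqxx.
by rewrite xq /= => cq; have [_ ->] := kP _ xq.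
Qed.

(** The right side at index [maxn i n] yields a transition of a smaller set at a late enough
    time. *)
Lemma GF_taken (A : nat -> set (S * S)) x : (forall i j, (i <= j)%N -> A j `<=` A i) ->
  \bigcap_(i in [set: nat]) GF M (A i) x = \bigcap_i taken_from M x (A i) i.
Proof.
move=> Adecr; apply/seteqP; split => [r rA i _|r rA i _ n]; first exact: rA.
have [m] := rA (maxn i n) Logic.I; rewrite geq_max => /andP[im nm] Am.
by exists m => //; exact: Adecr (leq_maxl i n) _ Am.
Qed.

Section objective.
Variable A : nat -> set (S * S).
Hypothesis A_decr : forall i j, (i <= j)%N -> A j `<=` A i.
Let phi : event M := fun s => \bigcap_(i in [set: nat]) GF M (A i) s.
Arguments phi : clear implicits.

Lemma run_measure_win (sigma : strategy M) (x : S) :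
  run_measure sigma x (phi x) = win A x (step sigma x).
Proof. by rewrite /phi GF_taken// run_measure_bigcap_taken. Qed.

Lemma value_best x : value phi x = best M A x.
Proof.
apply/eqP; rewrite eq_le; apply/andP; split; apply: ge_ereal_sup.
  by move=> _ [sigma _ <-]; rewrite run_measure_win win_best//; exact: step_plan.
move=> _ [k kP <-]; have [sigma sk] := plan_strategy kP.
apply: le_ereal_sup_tmp; exists (run_measure sigma x (phi x)); first by exists sigma.
by rewrite run_measure_win (win_ext A kP (fun q xq => esym (sk q xq))).
Qed.

Lemma optimal_opt x : (exists sigma, optimal phi x sigma) <-> optimizable M A x.
Proof.
split=> [[sigma]|[k [kP kw]]].
  rewrite /optimal run_measure_win value_best => so.
  by exists (step sigma x); split => //; exact: step_plan.
have [sigma sk] := plan_strategy kP; exists sigma.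
rewrite /optimal run_measure_win value_best -kw.
by apply: win_ext; [exact: step_plan|].
Qed.

End objective.

(** Visiting a finite [K] at arbitrarily late times means visiting one of its states infinitely
    often, a null event; by continuity from above, the probabilities of a visit from time [n] on
    have infimum 0. *)
Lemma universally_transient_transient : universally_transient M -> transient M.
Proof.
move=> ut K x k e kP e0; have [sigma sk] := plan_strategy kP.
have [N0 [mN N00 utN]] := ut x sigma.
set B := leaving K.
have I0 : run_measure sigma x (\bigcap_i taken_from M x B i) = 0.
  apply: (subset_measure0 _ mN) => //.
    by apply: bigcapT_measurable => i; exact: measurable_taken_from.
  move=> r rB; apply: utN => /=; apply.
  by apply: (@infinitely_often_mem _ r K) => n; have [m] := rB n Logic.I; exists m.
have := run_measure_bigcap_taken x sigma (B := fun=> B) (fun _ _ _ => @subset_refl _ _).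
rewrite I0 => inf0.
have : ereal_inf (range (fun i => reach_from B i x (step sigma x))) < e%:E.
  by rewrite -inf0 lte_fin.
move=> /ereal_inf_lt[_ [n _ <-] ltn]; exists n.
by rewrite (reach_from_ext B n kP (fun q xq => esym (sk q xq))) ltW.
Qed.

End plans_of_strategies.

(** * The product with a step counter *)

Section clock.
Context {R : realType} {S : countType} (M : mdp R S).
Local Open Scope ereal_scope.
Implicit Types (x t : S) (n : nat) (k : seq S -> S -> R) (B : set (S * S))
  (w : seq (S * nat) -> S * nat -> R).

Definition clock_controlled : pred (S * nat) := fun a => controlled M a.1.

Definition clock_trans : rel (S * nat) :=
  fun a b => trans M a.1 b.1 && (b.2 == a.2.+1).

Definition clock_distr n (d : S -> R) : S * nat -> R :=
  fun b => if b.2 == n.+1 then d b.1 else 0%R.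

Lemma clock_distr_tick n d t : clock_distr n d (t, n.+1) = d t.
Proof. by rewrite /clock_distr eqxx. Qed.

Let tick_inj (X : set S) n : set_inj X (fun t : S => (t, n)).
Proof. by move=> t u _ _ []. Qed.

Let clock_succ a : [set` clock_trans a] = [set (t, a.2.+1) | t in [set` trans M a.1]].
Proof.
apply/seteqP; split => [[t n]|_ [t at_ <-]] /=.
  by move=> /andP[at_ /eqP /= ->]; exists t.
by apply/andP; split => //=.
Qed.

Lemma is_distr_clock a d : is_distr (trans M a.1) d ->
  is_distr (clock_trans a) (clock_distr a.2 d).
Proof.
move=> [d0 dX d1]; split.
- by move=> b; rewrite /clock_distr; case: ifP.
- move=> b nab; rewrite /clock_distr; case: ifP => // ba; apply: dX.
  by apply: contra nab => ab; apply/andP; split.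
- rewrite clock_succ esum_image; last exact: tick_inj.
  by rewrite -d1; apply: eq_esum => t _; rewrite clock_distr_tick.
Qed.

Lemma is_distr_tick a (d : S * nat -> R) : is_distr (clock_trans a) d ->
  is_distr (trans M a.1) (fun t => d (t, a.2.+1)).
Proof.
move=> [d0 dX d1]; split => //.
- move=> t nat; apply: dX; apply: contra nat.
  by case/andP.
- by move: d1; rewrite clock_succ esum_image//; exact: tick_inj.
Qed.

Lemma clock_total a : exists b, clock_trans a b.
Proof.
by have [t at_] := trans_total M a.1; exists (t, a.2.+1); rewrite /clock_trans at_ /=.
Qed.

Lemma clock_prob_distr a : ~~ clock_controlled a ->
  is_distr (clock_trans a) (clock_distr a.2 (prob M a.1)).
Proof. by move=> ca; apply: is_distr_clock; exact: prob_distr. Qed.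

(* The product of [M] with a step counter: it is transient whatever [M] is, and
   its positional plans are the Markov plans of [M]. *)
Definition clock : mdp R (S * nat)%type := MDP clock_total clock_prob_distr.

Lemma avg_clock (d : S * nat -> R) f n : (forall b, (0 <= d b)%R) ->
  (forall b, b.2 != n -> d b = 0%R) -> (forall b, (0 < d b)%R -> 0 <= f b) ->
  avg d f = avg (fun t => d (t, n)) (fun t => f (t, n)).
Proof.
move=> d0 dn f0; rewrite /avg (esumID (range (fun t : S => (t, n)))); last first.
  by move=> b _; exact: avg_term_ge0.
rewrite !setTI [X in _ + X]esum1 ?adde0; last first.
  move=> [t m] /= tm; rewrite dn ?mul0e//=; apply/eqP => mn.
  by apply: tm; exists t => //; rewrite mn.
by rewrite esum_image//; exact: tick_inj.
Qed.

Lemma clock_path x n Q : path clock_trans (x, n) Q ->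
  path (trans M) x (unzip1 Q) /\ last (x, n) Q = (last x (unzip1 Q), (n + size Q)%N).
Proof.
elim: Q x n => [|[t m] Q IH] x n /=; first by rewrite addn0.
rewrite /clock_trans /= => /andP[/andP[xt /eqP ->] /IH[pQ ->]].
by rewrite xt addnS addSn.
Qed.

(** Lifts a path of [M] that starts at clock value [n]; the first state after the start reads
    [n.+1]. *)
Definition ticks n (q : seq S) : seq (S * nat) := zip q (iota n.+1 (size q)).

Lemma unzip1_ticks n q : unzip1 (ticks n q) = q.
Proof. by rewrite /ticks unzip1_zip// size_iota. Qed.

Lemma size_ticks n q : size (ticks n q) = size q.
Proof. by rewrite /ticks size_zip size_iota minnn. Qed.

Lemma path_ticks x n q : path (trans M) x q -> path clock_trans (x, n) (ticks n q).
Proof.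
elim: q x n => //= t q IH x n /andP[xt tq].
by rewrite /clock_trans /= xt eqxx /=; exact: IH.
Qed.

Lemma last_ticks x n q : path (trans M) x q ->
  last (x, n) (ticks n q) = (last x q, (n + size q)%N).
Proof. by move=> /(path_ticks n)/clock_path[_ ->]; rewrite unzip1_ticks size_ticks. Qed.

(** [unclock] and [on_clock] translate between plans of the product and of [M]. The clock reading is
    determined by the path length, so nothing is lost along paths. *)
Definition unclock n w : seq S -> S -> R :=
  fun q t => w (ticks n q) (t, (n + size q).+1).

Definition on_clock n k : seq (S * nat) -> S * nat -> R :=
  fun Q => clock_distr (n + size Q) (k (unzip1 Q)).

Lemma unclock_on_clock n k : unclock n (on_clock n k) = k.
Proof.
apply/funext => q; apply/funext => t.
by rewrite /unclock /on_clock /clock_distr size_ticks eqxx unzip1_ticks.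
Qed.

Lemma plan_unclock x n w : plan clock (x, n) w -> plan M x (unclock n w).
Proof.
move=> kP q xq; have [] := kP _ (path_ticks n xq).
rewrite last_ticks//= /clock_controlled /= => kD kprob; split.
  exact: (is_distr_tick kD).
move=> cq; apply/funext => t; rewrite /unclock kprob//.
by rewrite /clock_distr /= eqxx.
Qed.

Lemma plan_on_clock x n k : plan M x k -> plan clock (x, n) (on_clock n k).
Proof.
move=> kP Q /= /clock_path[xQ ->]; have [kD kprob] := kP _ xQ; split.
  exact: (@is_distr_clock (_, _)).
by rewrite /clock_controlled /= /on_clock => cQ; rewrite kprob.
Qed.

Lemma reach_unclock B N j x n w : plan clock (x, n) w ->
  reach [set e | B (e.1.1, e.2.1)] N j (x, n) w = reach B N j x (unclock n w).
Proof.
elim: N j x n w => [//|N IH] j x n w kP.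
have k0 := plan_ge0 kP; have kD := plan_distr kP; have [_ kX _] := kD.
have uE t : unclock n.+1 (residual w (t, n.+1)) = residual (unclock n w) t.
  apply/funext => q; apply/funext => u.
  by rewrite /unclock /residual /= addSnnS.
have IHt i t : (0 < w [::] (t, n.+1))%R ->
    reach [set e | B (e.1.1, e.2.1)] N i (t, n.+1) (residual w (t, n.+1)) =
    reach B N i t (residual (unclock n w) t).
  by move=> kt; rewrite IH ?uE//; exact: plan_supp kP kt.
rewrite !reachE (avg_clock (n := n.+1))//.
- rewrite (_ : unclock n w [::] = fun t => w [::] (t, n.+1)); last first.
    by apply/funext => t; rewrite /unclock /= addn0.
  case: j => [|j]; apply: avg_ext => // t kt; last exact: IHt.
  rewrite /taken_or -(IHt 0%N t kt); congr (if _ then _ else _).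
- by move=> [t m] /= mn; apply: kX; apply: contra mn => /andP[].
- move=> b kb; have rb := plan_supp kP kb.
  case: j => [|j]; last exact: (reach_ge0 _ _ _ rb).
  by rewrite /taken_or; case: ifP => _; [exact: lee01|exact: (reach_ge0 _ _ _ rb)].
Qed.

Lemma win_unclock A x n w : plan clock (x, n) w ->
  win (fun i => [set e | A i (e.1.1, e.2.1)]) (x, n) w = win A x (unclock n w).
Proof.
move=> kP; apply: (congr1 (fun h => ereal_inf (range h))); apply/funext => i.
apply: (congr1 (fun h => ereal_sup (range h))); apply/funext => N.
exact: reach_unclock.
Qed.

(** After [n] steps the clock reads [a.2 + n], past every reading in [K], so [K] cannot be met any
    more. *)
Lemma reach_clock_leaving (K : seq (S * nat)) N n a w : plan clock a w ->
  (forall b, b \in K -> (b.2 < a.2 + n)%N) -> reach (leaving K) N n a w = 0.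
Proof.
elim: N n a w => [//|N IH] n a w kP Ka; rewrite reachE.
rewrite -[RHS](avg_cst (plan_pmf kP))//; apply: avg_ext => [|b kb].
  exact: plan_ge0 kP.
have rb := plan_supp kP kb.
have : clock_trans a b := is_distr_supp (plan_distr kP) kb.
move=> /andP[_ /eqP ba].
case: n Ka => [|n] Ka; last first.
  by apply: IH => // c cK; rewrite ba addSnnS; exact: Ka.
rewrite taken_orF.
  by apply: IH => // c cK; rewrite ba addn0 ltnS ltnW//; have := Ka _ cK; rewrite addn0.
by move=> /Ka; rewrite addn0 ltnn.
Qed.

Lemma transient_clock : transient clock.
Proof.
move=> K a k e kP e0; exists (\max_(b <- K) b.2).+1.
apply: ge_ereal_sup => _ [N _ <-]; rewrite reach_clock_leaving ?lee_fin ?(ltW e0)//.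
by move=> b bK; rewrite addnS ltnS (leq_trans _ (leq_addl _ _))// leq_bigmax_seq.
Qed.

(** Serves both claims: an [f] that ignores the step count yields a positional strategy. *)
Lemma markov_strategy (f : S -> nat -> S) : (forall x n, trans M x (f x n)) ->
  exists sigma : strategy M,
    (forall h, sigma h = dirac_pmf (f (hist_last h) (hist_steps h))) /\
    forall x q, path (trans M) x q -> step sigma x q =
      if controlled M (last x q) then dirac_pmf (f (last x q) (size q))
      else prob M (last x q).
Proof.
move=> fP.
have fD (h : history M) : is_distr (trans M (hist_last h))
    (dirac_pmf (f (hist_last h) (hist_steps h)) : S -> R).
  by apply: is_distr_dirac; exact: fP.
exists (Strategy fD); split => // x q xq; rewrite /step; case: insubP => [h|].
  move=> /andP[_ /= ->] hE.
  by rewrite /= /hist_last /hist_steps hE.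
by rewrite xq /= => /negbTE ->.
Qed.

End clock.

(** * Optimal strategies in the MDP and in its clocked product *)

Theorem corollary13 (R : realType) (S : countType) (M : mdp R S) (s0 : S)
    (A : nat -> set (S * S))
    (A_trans : forall i, A i `<=` transitions M)
    (A_decr : forall i j, (i <= j)%N -> A j `<=` A i) :
  let phi : event M := fun s => \bigcap_(i in [set: nat]) GF M (A i) s in
  (universally_transient M ->
    exists sigma : strategy M,
      [/\ deterministic sigma, positional sigma &
          forall s, (exists tau, optimal phi s tau) -> optimal phi s sigma])
  /\
  ((exists tau, optimal phi s0 tau) ->
    exists sigma : strategy M,
      [/\ deterministic sigma, Markov sigma & optimal phi s0 sigma]).
Proof.
move=> phi; split.
  move=> /universally_transient_transient tr.
  have [g [gP gbest]] := positional_best A_decr tr.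
  have [sigma [sE stE]] := @markov_strategy R S M (fun x _ => g x) (fun x _ => gP x).
  exists sigma; split.
  - by move=> h; exists (g (hist_last h)); rewrite sE.
  - by move=> h h' hh'; rewrite !sE hh'.
  move=> s /(optimal_opt M A_decr) os.
  rewrite /optimal run_measure_win// value_best// -(gbest _ os).
  by apply: win_ext; [exact: step_plan|move=> q sq; rewrite stE].
move=> /(optimal_opt M A_decr)[k [kP kw]].
(* The sets are pulled back along the projection that forgets the clock. *)
pose A' i : set ((S * nat) * (S * nat)) := [set e | A i (e.1.1, e.2.1)].
have A'_decr i j : (i <= j)%N -> A' j `<=` A' i by move=> ij e; exact: A_decr.
have [g [gP gbest]] := positional_best A'_decr (@transient_clock R S M).
have gE x n : g (x, n) = ((g (x, n)).1, n.+1).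
  by have /andP[_ /eqP/=] := gP (x, n); case: (g _) => t m /= ->.
have [sigma [sE stE]] := @markov_strategy R S M (fun x n => (g (x, n)).1)
  (fun x n => proj1 (andP (gP (x, n)))).
exists sigma; split.
- by move=> h; exists (g (hist_last h, hist_steps h)).1; rewrite sE.
- by move=> h h' hh' nn'; rewrite !sE hh' nn'.
have kw' : win A' (s0, 0%N) (on_clock 0 k) = best M A s0.
  by rewrite (win_unclock A (plan_on_clock (n := 0%N) kP)) unclock_on_clock.
have gplan : plan (clock M) (s0, 0%N) (positional_plan (clock M) g (s0, 0%N)).
  exact: positional_planP.
(* Plans translate in both directions with the same win probability. *)
have best_clock : best (clock M) A' (s0, 0%N) = best M A s0.
  apply/eqP; rewrite eq_le; apply/andP; split.
    apply: ge_ereal_sup => _ [w wP <-]; rewrite (win_unclock A wP).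
    by apply: win_best; exact: plan_unclock.
  by rewrite -kw'; apply: win_best; exact: plan_on_clock.
rewrite /optimal run_measure_win// value_best// -best_clock -gbest; last first.
  exists (on_clock 0 k); split; first exact: plan_on_clock.
  by rewrite kw' best_clock.
(* Along paths from [s0] the clock reads [size q], so [sigma] follows the positional plan with its
   clock forgotten. *)
rewrite (win_unclock A gplan); apply: win_ext; first exact: step_plan.
move=> q xq; rewrite stE//; apply/funext => t.
rewrite /unclock /positional_plan (last_ticks 0 xq) add0n /= /clock_controlled /=.
case: ifP => _; last by rewrite clock_distr_tick.
by rewrite /dirac_pmf gE xpair_eqE eqxx andbT.
Qed.
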